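(* Let $\{X(t)\}_{t\ge 0}$ be the real-valued Lévy process (St. Petersburg semistable Lévy process) with $\mathbb{E}[e^{iyX(t)}]=\exp(t\psi(y))$ for all $t\ge0$, $y\in\mathbb{R}$, where $$\psi(y)=\int_{0+}^\infty \left(e^{iyx}-1-iyx\,1_{\{x\le 1\}}\right)d\phi(x)$$ and the Lévy measure $\phi$ is concentrated on $\{2^k:k\in\mathbb{Z}\}$ with $\phi(\{2^k\})=2^{-k}$. For $t\in[\frac12,1]$ let $Y(t)=t^{-1}(X(t)-t\log_2 t)$, and let $Y([\frac12,1])=\{Y(t):t\in[\frac12,1]\}\subseteq\mathbb{R}$ be the range. Then almost surely $$\dim_{\rm H} Y([\tfrac12,1])=1.$$
   Context: $\dim_{\rm H}$ denotes Hausdorff dimension. $\log_2$ is the logarithm to base $2$. Explicitly, $\psi(y)=\sum_{k\in\mathbb{Z}}2^{-k}\left(e^{iy2^k}-1-iy2^k1_{\{k\le 0\}}\right)$. A Lévy process starts at $0$, has stationary independent increments and càdlàg sample paths. *)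

(* Defs.v *)
From HB Require Import structures.
From mathcomp Require Import all_boot all_order all_algebra.
From mathcomp Require Import all_classical all_reals all_analysis.
From mathcomp Require Import complex.

Set Implicit Arguments.
Unset Strict Implicit.
Unset Printing Implicit Defensive.

Import Order.TTheory GRing.Theory Num.Theory.
Import numFieldNormedType.Exports.

Local Open Scope classical_set_scope.
Local Open Scope complex_scope.
Local Open Scope ring_scope.

Section Hausdorff.
Context {R : realType}.
Implicit Types (A U : set R) (s delta : R).

Local Open Scope ereal_scope.

(* Supremum of distances; it is -oo (not 0) on the empty set. *)
Definition diameter A : \bar R :=
  ereal_sup [set `|p.1 - p.2|%:E | p in A `*` A].

(* |U|^s with the convention |set0|^s = 0 for every s, including s = 0, so that
   a countable cover may be padded with empty sets. Note that 0 `^ 0 = 1. *)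
Definition diameter_pow s U : \bar R :=
  if `[< U = set0 >] then 0 else diameter U `^ s.

Definition hausdorff_pre s delta A : \bar R :=
  ereal_inf [set \sum_(0 <= n <oo) diameter_pow s (U n) | U in
    [set U : (set R)^nat |
      A `<=` \bigcup_n U n /\ forall n, diameter (U n) <= delta%:E]].

(* The limit as delta -> 0+ is a supremum, since hausdorff_pre is nonincreasing
   in delta. *)
Definition hausdorff_measure s A : \bar R :=
  ereal_sup [set hausdorff_pre s delta A | delta in [set delta | (0 < delta)%R]].

Definition hausdorff_dim A : \bar R :=
  ereal_inf [set s%:E | s in
    [set s | (0 <= s)%R /\ hausdorff_measure s A = 0]].

End Hausdorff.

Definition log2 {R : realType} (x : R) : R := ln x / ln 2.

Section Complex.
Context {R : realType}.

Definition cexp (z : R[i]) : R[i] :=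
  (expR (complex.Re z))%:C * (cos (complex.Im z) +i* sin (complex.Im z)).

Definition cintegral d (T : measurableType d) (mu : {measure set T -> \bar R})
    (D : set T) (f : T -> R[i]) : R[i] :=
  Rintegral mu D (fun x => complex.Re (f x)) +i* Rintegral mu D (fun x => complex.Im (f x)).

End Complex.

Section Probability.
Context {R : realType} d {T : measurableType d} (P : probability T R).

Definition char_fun (Z : T -> R) (y : R) : R[i] :=
  cintegral P setT (fun w => cexp ('i%C * (y * Z w)%:C)).

(* Taking some B i = setT gives the product rule for all subfamilies. *)
Definition mutually_independent (n : nat) (Z : 'I_n -> T -> R) : Prop :=
  forall B : 'I_n -> set R, (forall i, measurable (B i)) ->
    P (\bigcap_i (Z i @^-1` B i)) = (\prod_(i < n) P (Z i @^-1` B i))%E.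

Definition cadlag (f : R -> R) : Prop :=
  (forall t, 0 <= t -> f s @[s --> t^'+] --> f t) /\
  (forall t, 0 < t -> cvg (f s @[s --> t^'-])).

(* Time is [0, +oo[: the values X t for t < 0 are irrelevant. *)
Record levy_process (X : R -> T -> R) : Prop := {
  levy_measurable : forall t, 0 <= t -> measurable_fun setT (X t) ;
  levy_start : {ae P, forall w, X 0 w = 0} ;
  levy_independent_increments :
    forall (n : nat) (t : nat -> R),
      0 <= t 0%N -> (forall i j, (i < j)%N -> t i < t j) ->
      mutually_independent (fun (i : 'I_n) w => X (t i.+1) w - X (t i) w) ;
  levy_stationary_increments :
    forall s h, 0 <= s -> 0 <= h -> forall B : set R, measurable B ->
      P [set w | B (X (s + h) w - X s w)] = P [set w | B (X h w - X 0 w)] ;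
  levy_cadlag : {ae P, forall w, cadlag (fun t => X t w)}
}.

End Probability.

Section StPetersburg.
Context {R : realType}.

Definition st_petersburg_levy_measure
    (phi : {measure set (measurableTypeR R) -> \bar R}) : Prop :=
  phi (~` [set (2 : R) ^ k | k in [set: int]]) = 0%E /\
  forall k : int, phi [set (2 : R) ^ k] = ((2 : R) ^ (- k))%:E.

Definition levy_exponent
    (phi : {measure set (measurableTypeR R) -> \bar R}) (y : R) : R[i] :=
  cintegral phi `]0, +oo[
    (fun x : R =>
       cexp ('i%C * (y * x)%:C) - 1 - 'i%C * (y * x)%:C * (x <= 1)%R%:R).

Definition st_petersburg_normalized (T : Type) (X : R -> T -> R)
    (t : R) (w : T) : R :=
  t^-1 * (X t w - t * log2 t).

End StPetersburg.

(* Main.v *)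
(* X has no negative jumps, so neither has Y, and a cadlag path without downward
   jumps takes every value between Y(b) and Y(a) whenever a < b and Y(b) < Y(a).
   It then suffices that almost surely Y(b) < Y(1/2) for some b in (1/2, 1]: the
   range contains a nondegenerate interval.

   The descent: semistability gives psi(2y) = 2 psi(y) - 2iy, so that
   2^m X(2^-m) + m has the same characteristic function for all m; its tails are
   therefore uniformly small, and X(1/2 + h) - X(1/2) < - K h with probability
   tending to 1 as h = 2^-m tends to 0, for every K.

   No negative jumps: it is enough that n P(X(1/n) in [-K, -eps]) tends to 0.  For
   a trigonometric polynomial p >= 0 with p(0) = 0 one has n E p(X(1/n)) -->
   int p dphi, and p is taken to be a product of factors 1 - cos vanishing at the
   atoms 2^k above a small level, but bounded below on [-K, -eps]. *)
Require Import Defs.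
From HB Require Import structures.
From mathcomp Require Import all_boot all_order all_algebra.
From mathcomp Require Import all_classical all_reals all_analysis.
From mathcomp Require Import complex.
From mathcomp Require Import measurable_realfun ring lra.

Set Implicit Arguments.
Unset Strict Implicit.
Unset Printing Implicit Defensive.

Import Order.TTheory GRing.Theory Num.Theory.
Import numFieldNormedType.Exports.

Local Open Scope classical_set_scope.
Local Open Scope complex_scope.
Local Open Scope ring_scope.

(** * Hausdorff measure and dimension of subsets of the line *)

Section HausdorffDimension.
Context {R : realType}.
Implicit Types (A U : set R) (s : R).

(** The ratio of the two powers on the right is exp (t (ln (x + 1) - ln x)), which is at least 1 + t
    / (x + 1). This replaces the comparison of a power sum with an integral. *)
Lemma powRN_telescope (t x : R) : 0 < t -> 0 < x ->
  t * (x + 1) `^ (- (t + 1)) <= x `^ (- t) - (x + 1) `^ (- t).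
Proof.
move=> t0 x0; have x1 : 0 < x + 1 by rewrite addr_gt0.
have lnx : (x + 1)^-1 <= ln (x + 1) - ln x.
  have := @le_ln1Dx R (- (x + 1)^-1).
  have -> : 1 + - (x + 1)^-1 = x / (x + 1) by field; rewrite gt_eqF.
  rewrite ln_div ?posrE// => /(_ _)/wrap[|]; last by lra.
  by rewrite ltrN2 invf_lt1// ltrDr.
rewrite opprD powRD; last by rewrite (gt_eqF x1) implybT.
rewrite powR_inv1 ?(ltW x1)// lerBrDr.
rewrite {2 3}/powR (gt_eqF x1) (gt_eqF x0).
have -> : expR (- t * ln x) = expR (- t * ln (x + 1)) * expR (t * (ln (x + 1) - ln x)).
  by rewrite -expRD; congr expR; ring.
rewrite {1}/powR (gt_eqF x1) mulrCA -[X in _ + X <= _]mulr1 -mulrDr ler_pM2l ?expR_gt0//.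
rewrite addrC; apply: le_trans (expR_ge1Dx _).
by rewrite lerD2l ler_pM2l.
Qed.

Lemma riemann_sum_le s n : 1 < s ->
  \sum_(0 <= i < n) (i.+1%:R `^ (- s)) <= 1 + (s - 1)^-1 :> R.
Proof.
move=> s1; have t0 : 0 < s - 1 by rewrite subr_gt0.
case: n => [|n]; first by rewrite big_geq// addr_ge0// invr_ge0 ltW.
(* The subtracted remainder makes the bound inductive: by [powRN_telescope] each new term is
   absorbed by the decrease of the remainder. *)
apply: (@le_trans _ _ (1 + (s - 1)^-1 * (1 - n.+1%:R `^ (- (s - 1))))).
  elim: n => [|n IH]; first by rewrite big_nat1 !powR1 subrr mulr0 addr0.
  rewrite big_nat_recr//=; apply: le_trans (lerD IH (lexx _)) _.
  rewrite -addrA lerD2l -lerBrDl -mulrBr ler_pdivlMl//.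
  have := @powRN_telescope (s - 1) n.+1%:R t0 (ltr0Sn _ _).
  rewrite subrK natr1; lra.
by rewrite lerD2l ger_pMr ?invr_gt0// gerBl powR_ge0.
Qed.

Lemma harmonic_bracket (x : R) : 0 <= x ->
  exists m, series harmonic m <= x <= series harmonic m.+1.
Proof.
move=> x0.
have [n xn] : exists n, x < series harmonic n.
  apply: contrapT => /forallNP H; apply: (@dvg_harmonic R).
  apply: nondecreasing_is_cvgn.
    by apply/nondecreasing_series => i _ _; exact: harmonic_ge0.
  by exists x => _ [n _ <-]; rewrite leNgt; apply/negP/H.
have ex : exists n, x < series harmonic n by exists n.
case: (ex_minnP ex) => -[|m] xm minm.
  by move: xm; rewrite /series/= big_geq// ltNge x0.
exists m; rewrite (ltW xm) andbT leNgt; apply/negP => /minm.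
by rewrite ltnn.
Qed.

Lemma diameter_le U (r : R) :
  (forall y z, U y -> U z -> `|y - z| <= r) -> (diameter U <= r%:E)%E.
Proof.
move=> H; apply: ge_ereal_sup => _ [[y z] [/= Uy Uz] <-].
by rewrite lee_fin H.
Qed.

Lemma diameter_ge U (y z : R) : U y -> U z -> (`|y - z|%:E <= diameter U)%E.
Proof. by move=> Uy Uz; apply: ereal_sup_ubound; exists (y, z). Qed.

Lemma diameter_pow_ge0 s U : (0 <= diameter_pow s U)%E.
Proof. by rewrite /diameter_pow; case: ifP => // _; exact: poweR_ge0. Qed.

Lemma diameter_pow_le s U (r : R) : 0 < s -> 0 <= r -> (diameter U <= r%:E)%E ->
  (diameter_pow s U <= (r `^ s)%:E)%E.
Proof.
move=> s0 r0 Ur; rewrite /diameter_pow; case: asboolP => [_|U0].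
  by rewrite lee_fin powR_ge0.
have [x Ux] : exists x, U x by apply/set0P/eqP.
have D0 : (0 <= diameter U)%E.
  by apply: le_trans (diameter_ge Ux Ux); rewrite subrr normr0.
rewrite -poweR_EFin; apply: gt0_ler_poweR; rewrite ?(ltW s0) ?in_itv/= ?leey ?andbT//.
Qed.

(* R is covered by intervals of lengths c, c/2, c/3, ...: these have infinite
   total length, but the sum of their s-th powers is O(c ^ s). *)
Lemma hausdorff_measure0 s A : 1 < s -> hausdorff_measure s A = 0%E.
Proof.
move=> s1; have s0 : 0 < s by apply: lt_trans s1.
apply/eqP; rewrite eq_le; apply/andP; split; last first.
  apply: le_ereal_sup_tmp; exists (hausdorff_pre s 1 A); first by exists 1 => /=.
  apply: le_ereal_inf_tmp => _ [U _ <-].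
  by apply: nneseries_ge0 => n _ _; exact: diameter_pow_ge0.
apply: ge_ereal_sup => _ [delta /= d0 <-].
apply/lee_addgt0Pr => e e0; rewrite add0e.
set B := 1 + (s - 1)^-1.
have B0 : 0 < B by rewrite addr_gt0// invr_gt0 subr_gt0.
(* All diameters will be at most [c * 2]. The first bound on [c] keeps them below [delta], the
   second makes [(c * 2) ^ s * B] at most [e]. *)
pose c := Num.min (delta / 2) ((e / B) `^ s^-1 / 2).
have c0 : 0 < c by rewrite /c lt_min !divr_gt0//; apply: powR_gt0; rewrite divr_gt0.
(* Even indices cover the right half-line and odd ones the left, by cells between consecutive
   harmonic sums scaled by [c]. Cell [n] has length [c / (n./2 + 1)], at most [2 c / (n + 1)]. *)
pose sg n : R := if odd n then -1 else 1.
pose U n := [set x : R | series harmonic n./2 <= sg n * x / c <= series harmonic n./2.+1].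
have dU n : (diameter (U n) <= (c * 2 / n.+1%:R)%:E)%E.
  apply: diameter_le => // y z /andP[y1 y2] /andP[z1 z2].
  have E : series harmonic n./2.+1 - series harmonic n./2 = (n./2.+1%:R)^-1 :> R.
    by rewrite seriesSB.
  have sg1 : `|sg n| = 1 by rewrite /sg; case: ifP; rewrite ?normrN normr1.
  have -> : `|y - z| = c * `|sg n * y / c - sg n * z / c|.
    rewrite -mulrBl -mulrBr !normrM sg1 mul1r normfV (gtr0_norm c0) mulrC divfK//.
    by rewrite gt_eqF.
  rewrite -(mulrA c) ler_pM2l//.
  apply: (@le_trans _ _ (n./2.+1%:R)^-1).
    by rewrite -E ler_norml; apply/andP; split; lra.
  rewrite ler_pdivlMr// mulrC ler_pdivrMr// -natrM ler_nat.
  by rewrite -{1}(odd_double_half n) mul2n doubleS; case: (odd n).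
apply: ge_ereal_inf; exists (\sum_(0 <= n <oo) diameter_pow s (U n))%E.
  exists U => //; split.
    move=> x _; have [m mx] := @harmonic_bracket (`|x| / c) (divr_ge0 (normr_ge0 _) (ltW c0)).
    have [x0|x0] := leP 0 x.
      exists m.*2 => //; rewrite /U/= doubleK /sg odd_double mul1r.
      by rewrite ger0_norm// in mx.
    exists m.*2.+1 => //; rewrite /U/= uphalf_double /sg/= odd_double/= mulN1r.
    by rewrite ltr0_norm// in mx.
  move=> n; apply: le_trans (dU n) _; rewrite lee_fin.
  apply: (@le_trans _ _ (c * 2)).
    by rewrite ler_pdivrMr// ler_peMr ?mulr_ge0 ?(ltW c0)// ler1n.
  by rewrite -ler_pdivlMr// /c ge_min lexx.
apply: (@le_trans _ _ (\sum_(0 <= n <oo) ((c * 2) `^ s * n.+1%:R `^ (- s))%:E)%E).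
  apply: lee_nneseries => n *; first exact: diameter_pow_ge0.
  apply: le_trans (diameter_pow_le s0 _ (dU n)) _.
    by rewrite !mulr_ge0 ?invr_ge0// ltW.
  by rewrite lee_fin powRM ?mulr_ge0 ?invr_ge0 ?(ltW c0)// -(powR_inv1 (ler0n _ n.+1)) -powRrM mulN1r.
apply: lime_le.
  by apply: is_cvg_nneseries => n _ _; rewrite lee_fin mulr_ge0// powR_ge0.
near=> n; rewrite sumEFin lee_fin -mulr_sumr.
apply: le_trans (ler_wpM2l (powR_ge0 _ _) (riemann_sum_le _ s1)) _.
rewrite -/B -ler_pdivlMr//.
have -> : e / B = ((e / B) `^ s^-1) `^ s by rewrite -powRrM mulVf ?gt_eqF// powRr1// ltW// divr_gt0.
apply: ge0_ler_powR; rewrite ?nnegrE ?(ltW s0) ?mulr_ge0 ?(ltW c0) ?powR_ge0//.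
by rewrite -ler_pdivlMr// /c ge_min lexx orbT.
Unshelve. all: by end_near.
Qed.

(** A nonempty set of diameter r <= 1 lies in a closed interval of length 2 r around one of its
    points, and r <= r ^ s because s <= 1. Subadditivity of Lebesgue measure then bounds every cover
    sum below by (q - p) / 2. The intervals stand in for the sets of the cover, which may fail to be
    measurable. *)
Lemma hausdorff_measure_gt0 s (p q : R) A : 0 <= s <= 1 -> p < q ->
  `]p, q[ `<=` A -> (0 < hausdorff_measure s A)%E.
Proof.
move=> /andP[s0 s1] pq pqA.
apply: (@lt_le_trans _ _ ((q - p) / 2)%:E); first by rewrite lte_fin divr_gt0// subr_gt0.
apply: le_ereal_sup_tmp; exists (hausdorff_pre s 1 A); first by exists 1 => /=.
apply: le_ereal_inf_tmp => _ [U [AU dU] <-].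
pose x n := get (U n); pose r n := fine (diameter (U n)).
pose V n : set R := if `[< U n = set0 >] then set0 else `[x n - r n, x n + r n]%classic.
have rP n : U n !=set0 -> [/\ U n (x n), 0 <= r n & diameter (U n) = (r n)%:E].
  move=> [y Uy]; have Ux : U n (x n) by rewrite /x; apply: getPex; exists y.
  have D0 : (0 <= diameter (U n))%E.
    by apply: le_trans (diameter_ge Uy Uy); rewrite subrr normr0.
  split => //; first exact: fine_ge0.
  by rewrite /r fineK// ge0_fin_numE// (le_lt_trans (dU n)) ?ltry.
have UV n : U n `<=` V n.
  move=> y Uy; rewrite /V; case: asboolP => [U0|_]; first by move: Uy; rewrite U0.
  have [|Ux r0 E] := rP n; first by exists y.
  have := diameter_ge Uy Ux; rewrite E lee_fin => H.
  by rewrite /= in_itv/= -ler_distl.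
have mV n : measurable (V n) by rewrite /V; case: ifP.
have VU n : (lebesgue_measure (V n) <= 2%:E * diameter_pow s (U n))%E.
  rewrite /V /diameter_pow; case: asboolP => [U0|/eqP/set0P Un].
    by rewrite measure0 mule0.
  have [Ux r0 E] := rP n Un; have := dU n; rewrite E lee_fin => r1.
  have rs : r n <= r n `^ s.
    have [->|r00] := eqVneq (r n) 0; first exact: powR_ge0.
    by rewrite -{1}(powRr1 r0) ger_powR// lt_neqAle eq_sym r00 r0.
  rewrite poweR_EFin lebesgue_measure_itv/= lte_fin; case: ifPn => _.
    by rewrite -?EFinD -?EFinM ?lee_fin; lra.
  by rewrite -EFinM lee_fin mulr_ge0// powR_ge0.
have : (lebesgue_measure `]p, q[%classic <= \sum_(0 <= n <oo) lebesgue_measure (V n))%E.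
  apply: measure_sigma_subadditive => //.
  apply: subset_trans pqA _; apply: subset_trans AU _.
  by apply: subset_bigcup => n _; exact: UV.
rewrite lebesgue_measure_itv/= lte_fin pq -EFinD => H.
have : ((q - p)%:E <= 2%:E * \sum_(0 <= n <oo) diameter_pow s (U n))%E.
  apply: le_trans H _; rewrite -nneseriesZl//; last by move=> i _; exact: diameter_pow_ge0.
  by apply: lee_nneseries.
by rewrite muleC EFinM lee_pdivrMr.
Qed.

Lemma hausdorff_dim_interval (p q : R) A : p < q -> `]p, q[ `<=` A ->
  hausdorff_dim A = 1%:E.
Proof.
move=> pq pqA; apply/eqP; rewrite eq_le; apply/andP; split.
  apply/lee_addgt0Pr => e e0.
  apply: ge_ereal_inf; exists (1 + e)%:E => //; exists (1 + e) => //=; split.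
    by rewrite addr_ge0// ltW.
  by rewrite hausdorff_measure0// ltrDl.
apply: le_ereal_inf_tmp => _ [s [/= s0 H0] <-]; rewrite lee_fin leNgt; apply/negP => s1.
have := @hausdorff_measure_gt0 s p q A; rewrite s0 (ltW s1) H0 ltxx.
by move=> /(_ isT pq pqA).
Qed.

End HausdorffDimension.

(** * Intermediate values of paths without downward jumps *)

Section PathsWithoutDownwardJumps.
Context {R : realType}.

Definition no_downward_jump (f : R -> R) (t : R) :=
  exists2 l, f s @[s --> t^'-] --> l & l <= f t.

(** Let [tau] be the infimum of the times at which [f] is at most [c]. Right continuity gives
    [f tau <= c]. Before [tau] the path is above [c], so its left limit there is at least [c], and
    so is [f tau], which cannot lie below that limit. *)
Lemma no_downward_jump_IVT (f : R -> R) (a b c : R) : a < b ->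
  (forall t, a <= t < b -> f s @[s --> t^'+] --> f t) ->
  (forall t, a < t <= b -> no_downward_jump f t) ->
  f b < c < f a -> exists2 t, a <= t <= b & f t = c.
Proof.
move=> ab rc nd /andP[bc ca].
pose S := [set t | a <= t <= b /\ f t <= c].
have Sb : S b by split; [rewrite (ltW ab) lexx|exact: ltW].
have lS : lbound S a by move=> t [/andP[]].
have hS : has_inf S by split; [exists b|exists a].
pose tau := inf S.
have at_ : a <= tau by apply: lb_le_inf => //; exists b.
have tb : tau <= b by apply: ge_inf => //; exists a.
have below t : a <= t -> t < tau -> c < f t.
  move=> at1 tt; rewrite ltNge; apply/negP => ftc.
  have : tau <= t by apply: ge_inf; [exists a|split => //; rewrite at1 (le_trans (ltW tt))].
  by rewrite leNgt tt.
have ftau : f tau <= c.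
  rewrite leNgt; apply/negP => cf.
  have tb' : tau < b.
    by rewrite lt_neqAle tb andbT; apply/eqP => E; move: cf; rewrite E ltNge (ltW bc).
  have := rc tau; rewrite at_ tb' => /(_ isT) /cvgr_gt /(_ c cf).
  rewrite near_withinE => -[e /= e0 He].
  have [s Ss sl] := inf_adherent e0 hS.
  have : tau <= s by apply: ge_inf => //; exists a.
  rewrite le_eqVlt => /orP[/eqP E|ts].
    by move: Ss => [_]; rewrite -E leNgt cf.
  have := He s; rewrite /ball/= ltr0_norm ?subr_lt0// opprB ltrBlDl => /(_ sl ts).
  by rewrite ltNge (Ss.2).
exists tau; first by rewrite at_ tb.
(* Since [f a > c], there is room to the left of [tau] for the left limit to be compared with
   [c]. *)
have at' : a < tau.
  by rewrite lt_neqAle at_ andbT; apply/eqP => E; move: ftau; rewrite -E leNgt ca.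
have := nd tau; rewrite at' tb => /(_ isT)[l fl lf].
apply/eqP; rewrite eq_le ftau/=; apply: le_trans lf.
rewrite leNgt; apply/negP => lc.
have := @filter_ex _ (tau^'-) _ _ (filterI (nbhs_left_gt at') (filterI (nbhs_left_lt tau) (cvgr_lt _ fl c lc))).
move=> [s [as_ [st fs]]].
by have := below s (ltW as_) st; rewrite ltNge (ltW fs).
Qed.

End PathsWithoutDownwardJumps.

(** * Elementary bounds on sine and cosine *)

Section TrigonometricBounds.
Context {R : realType}.

Lemma norm_sin_le (x : R) : `|sin x| <= `|x|.
Proof.
wlog x0 : x / 0 <= x => [H|].
  have [/H//|/ltW x0] := leP 0 x.
  by rewrite -normrN -sinN -(normrN x) H// oppr_ge0.
have [c _] := @MVT_segment R sin cos 0 x x0 (fun y _ => is_derive_sin y)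
  (continuous_subspaceT (@continuous_sin R)).
rewrite sin0 !subr0 => ->; rewrite normrM.
by apply: ler_piMl; rewrite ?cos_max.
Qed.

Lemma subr1_cos_le_sqr (x : R) : 1 - cos x <= x ^+ 2 / 2.
Proof.
have -> : cos x = 1 - 2 * sin (x / 2) ^+ 2.
  have := cos_mulr2n (x / 2); rewrite sin2cos2.
  have -> : (x / 2) *+ 2 = x by rewrite -mulr_natr divfK.
  by move=> ->; ring.
have : sin (x / 2) ^+ 2 <= (x / 2) ^+ 2.
  by rewrite -(real_normK (num_real (sin _))) -(real_normK (num_real (x / 2))) ler_sqr ?nnegrE//; exact: norm_sin_le.
by lra.
Qed.

Lemma subr1_cos_le_norm (x : R) : 1 - cos x <= `|x|.
Proof.
have := subr1_cos_le_sqr x; have := cos_geN1 x; rewrite -real_normK ?num_real//.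
have := normr_ge0 x; move: `|x| => a a0 c1 H.
have [a2|a2] := leP a 2; last by lra.
apply: le_trans H _; rewrite ler_pdivrMr// expr2; exact: ler_wpM2l.
Qed.

(** By the mean value theorem, as the derivative cos - 1 is at most |x| in modulus on the segment. A
    quadratic bound is enough for domination by min (1, x^2). *)
Lemma norm_sinB_le (x : R) : `|sin x - x| <= x ^+ 2.
Proof.
wlog x0 : x / 0 <= x => [H|].
  have [/H//|/ltW x0] := leP 0 x.
  have := H (- x); rewrite oppr_ge0 sinN sqrrN opprK => /(_ x0).
  by rewrite -normrN opprD !opprK.
have dsub y : y \in `]0, x[%R -> is_derive y 1 (fun y : R => sin y - y) (cos y - 1).
  by move=> _; exact: is_deriveB.
have csub : {within `[0, x], continuous (fun y : R => sin y - y)}.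
  by apply: continuous_subspaceT => y; apply: cvgB; [exact: continuous_sin|exact: cvg_id].
have [c cx] := MVT_segment x0 dsub csub.
rewrite sin0 !subr0 => ->; rewrite normrM (ger0_norm x0) expr2.
apply: ler_wpM2r => //; rewrite distrC ger0_norm ?subr_ge0 ?cos_le1//.
by move: cx; rewrite in_itv/= => /andP[c0 cx]; rewrite (le_trans (subr1_cos_le_norm _))// ger0_norm.
Qed.

Lemma cos_antitone (u v : R) : 0 <= u -> u <= v -> v <= pi -> cos v <= cos u.
Proof.
move=> u0; rewrite le_eqVlt => /orP[/eqP <- //|uv] vp.
by rewrite ltW// ltr_cos ?in_itv/= ?u0 ?vp ?andbT//= ?(le_trans u0) ?(le_trans (ltW uv))// ltW.
Qed.

Lemma cos_2pi_natmul n : cos ((pi *+ 2) *+ n) = 1 :> R.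
Proof.
by elim: n => [|n IH]; rewrite ?mulr0n ?cos0// mulrS addrC cosD2pi.
Qed.

Lemma cos1_lt1 : cos 1 < 1 :> R.
Proof.
have p2 := @pi_ge2 R.
by rewrite -[ltRHS](@cos0 R) ltr_cos ?in_itv/= ?lexx ?ler01 ?ltr01 ?pi_ge0//=; lra.
Qed.

End TrigonometricBounds.

(** Numbering [D] injectively splits [A] within [D] into disjoint pieces that are empty or
    singletons, and sigma-additivity applies. No finiteness is assumed, so the lemma covers the Lévy
    measure, whose mass near 0 is infinite. *)
Lemma eq_measure_atoms d (T : measurableType d) (R : realType)
    (mu nu : {measure set T -> \bar R}) (D : set T) :
  (forall x : T, measurable [set x]) -> countable D ->
  mu (~` D) = 0%E -> nu (~` D) = 0%E ->
  (forall x, D x -> mu [set x] = nu [set x]) ->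
  forall A, measurable A -> mu A = nu A.
Proof.
move=> m1 cD muD nuD E A mA.
have mD : measurable D by exact: countable_measurable.
have /countable_injP[f injf] := cD.
pose F n := [set x | [/\ D x, A x & f x = n]].
have F01 n : F n = set0 \/ exists2 x, D x & F n = [set x].
  have [->|/set0P[x Fx]] := eqVneq (F n) set0; [by left|right].
  have [Dx Ax fx] := Fx; exists x => //; apply/seteqP; split=> [y [Dy Ay fy]|y -> //].
  by apply: injf; rewrite ?inE// fx fy.
have mF n : measurable (F n) by case: (F01 n) => [->|[x _ ->]].
have tF : trivIset setT F.
  by apply/trivIsetP => i j _ _ /eqP ij; apply/seteqP; split => // x [[_ _ fi] [_ _ fj]]; case: ij; rewrite -fi.
have AD : A `&` D = \bigcup_n F n.
  apply/seteqP; split => [x [Ax Dx]|x [n _ [Dx Ax _]]] //.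
  by exists (f x).
have H (m : {measure set T -> \bar R}) : m (~` D) = 0%E ->
    m A = (\sum_(i <oo | i \in setT) m (F i))%E.
  move=> mD0; rewrite -measure_bigcup// -AD.
  rewrite -[in LHS](setUIDK A D) measureU//; last 3 first.
    exact: measurableI. exact: measurableD.
    by rewrite setIACA setICr setI0.
  rewrite setDE [X in (_ + X)%E](_ : _ = 0%E) ?adde0//.
  apply/eqP; rewrite eq_le measure_ge0 andbT -mD0; apply: le_measure; rewrite ?inE//.
    by apply: measurableI => //; exact: measurableC.
  exact: measurableC.
rewrite !H//; apply: eq_eseriesr => i _.
by case: (F01 i) => [->|[x Dx ->]]; rewrite ?measure0// E.
Qed.

(** * The Lévy measure and its integrals as dyadic series *)

Section LevyExponent.
Context {R : realType} (phi : {measure set (measurableTypeR R) -> \bar R}).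
Hypothesis phiP : st_petersburg_levy_measure phi.

Definition psi_re (y : R) : R :=
  (\int[phi]_(x in `]0%R, +oo[) (cos (y * x) - 1))%R.
Definition psi_im (y : R) : R :=
  (\int[phi]_(x in `]0%R, +oo[) (sin (y * x) - y * x * (x <= 1)%R%:R))%R.

Lemma levy_exponentE y : levy_exponent phi y = psi_re y +i* psi_im y.
Proof.
rewrite /levy_exponent /cintegral /psi_re /psi_im; congr (_ +i* _);
  apply: eq_Rintegral => x _; rewrite /cexp/=;
  rewrite !(mul0r, mul1r, mulr0, addr0, add0r, subr0, sub0r, oppr0, expR0);
  by case: (x <= 1); rewrite ?mulr1 ?mulr0/= ?(mul0r, mul1r, mulr0, subr0, oppr0, addr0, mulr1, add0r).
Qed.

Lemma countable_dyadic : countable [set (2 : R) ^ k | k in [set: int]].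
Proof. exact: card_le_trans (card_image_le _ _) (countableP _). Qed.

(** Semistability of the Lévy measure: doubling moves the atom at 2^(k-1), of mass 2 * 2^(-k), to
    2^k. *)
Lemma phi_double (A : set (measurableTypeR R)) : measurable A ->
  phi [set x | A (2 * x)] = (2%:E * phi A)%E.
Proof.
have mg : measurable_fun [set: measurableTypeR R] (fun x : R => 2 * x : measurableTypeR R).
  exact: mulrl_measurable.
have doubleE (x : R) k : 2 * x = 2 ^ k <-> x = 2 ^ (k - 1).
  rewrite -[in X in X <-> _](subrK 1 k) expfzDr// expr1z mulrC.
  by split=> [/mulIf->|->].
move=> mA.
apply: (@eq_measure_atoms _ _ _ (pushforward phi (fun x : R => 2 * x : measurableTypeR R))
   (mscale (2%:nng) phi) _ _ countable_dyadic) => //.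
- rewrite /pushforward -[RHS]phiP.1; congr (phi _); apply/seteqP; split => x /= H [k _ E]; apply: H.
    by exists (k + 1) => //; apply/esym/doubleE; rewrite addrK E.
  by exists (k - 1) => //; apply/esym/doubleE.
- by transitivity (2%:E * 0 : \bar R)%E; [congr (_ * _)%E; exact: phiP.1|exact: mule0].
- move=> _ [k _ <-].
  transitivity (phi [set (2 : R) ^ (k - 1)]).
    by congr (phi _); apply/seteqP; split=> x /= /doubleE.
  transitivity (2%:E * (2 ^ (- k))%:E : \bar R)%E; last by congr (_ * _)%E; exact/esym/phiP.2.
  transitivity ((2 ^ (- (k - 1)))%:E : \bar R); first exact: phiP.2.
  by rewrite -EFinM opprB addrC expfzDr// expr1z mulrC.
Qed.

(** The sequence [k] enumerates, without repetition, the exponents of the atoms in [E]; the rest of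
    [E] is null. *)
Lemma integral_dyadic (k : nat -> int) (f : R -> \bar R) (E : set (measurableTypeR R)) :
  injective k -> (forall x, 0 <= f x)%E ->
  measurable_fun [set: measurableTypeR R] f -> measurable E ->
  (forall j : int, E (2 ^ j) <-> exists n, j = k n) ->
  (\int[phi]_(x in E) f x = \sum_(0 <= n <oo) (2 ^ (- k n))%:E * f (2 ^ (k n)))%E.
Proof.
move=> kinj f0 mf mE Ek.
have mD : measurable [set (2 : R) ^ k | k in [set: int]].
  by apply: countable_measurable => //; exact: countable_dyadic.
rewrite (@ge0_negligible_integral _ _ _ phi E (~` [set (2 : R) ^ k | k in [set: int]]))//.
- have -> : E `\` ~` [set (2 : R) ^ k | k in [set: int]] = \bigcup_n [set (2 : R) ^ (k n)].
    apply/seteqP; split => [x [Ex] /= /contrapT[j _ jx]|x [n _ ->]]; last first.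
      split; first by apply/Ek; exists n.
      by move=> H; apply: H; exists (k n).
    by move: Ex; rewrite -jx => /Ek[n ->]; exists n.
  rewrite ge0_integral_bigcup//; last 2 first.
    by apply: measurable_funS mf.
    apply/trivIsetP => i j _ _ ij; apply/seteqP; split=> // x [/= ->].
    move/ieexprIz/kinj => H; move: ij.
    by rewrite H ?eqxx// pnatr_eq1.
  apply: eq_eseriesr => n _.
  rewrite (eq_integral (cst (f (2 ^ k n)))); last by move=> x; rewrite inE => ->.
  by rewrite integral_cst// muleC; congr (_ * _)%E; exact: phiP.2.
- exact: measurableC.
- by apply: measurable_funS mf.
- exact: phiP.1.
Qed.

Lemma half_series_le (c : R) : 0 <= c ->
  (\sum_(0 <= n <oo) (c / 2 ^+ n)%:E <= (2 * c)%:E)%E.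
Proof.
move=> c0.
rewrite (_ : \sum_(0 <= n <oo) _ = (2 * c)%:E)%E//.
have := @cvg_geometric_eseries_half R (2 * c) 0.
rewrite expr0 divr1 => /(cvg_lim _) <- //.
congr (limn _); apply/funext => n; apply: eq_bigr => i _; congr (_%:E).
by rewrite addn1 natrX exprS -mulf_div divff// mul1r.
Qed.

Lemma exprzBn (k : int) n : (2 : R) ^ (k - n%:Z) = 2 ^ k / 2 ^+ n.
Proof. by rewrite expfzDr// -invr_expz. Qed.

Lemma int_sqr_le (k : int) :
  (\int[phi]_(x in `]0%R, (2 : R) ^ k]) (x ^+ 2)%:E <= (2 * 2 ^ k)%:E)%E.
Proof.
have k0 : (0 : R) <= 2 ^ k by rewrite exprz_ge0.
rewrite (@integral_dyadic (fun n => k - n%:Z))//.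
- apply: le_trans _ (half_series_le k0); apply: lee_nneseries => n *.
    by rewrite mule_ge0// lee_fin ?exprz_ge0// sqr_ge0.
  rewrite -EFinM lee_fin -invr_expz expr2 mulrA mulVf ?mul1r ?exprzBn//.
  by rewrite mulf_neq0// ?invr_eq0 expfz_neq0.
- by move=> i j /addrI/oppr_inj[].
- by move=> x; rewrite lee_fin sqr_ge0.
- by apply/measurable_EFinP; exact: exprn_measurable.
- move=> j; rewrite /= in_itv/= exprz_gt0//= ler_eXz2l ?ltr1n//; split.
    by rewrite -subr_ge0; case E : (k - j) => [n|//] _; exists n; rewrite -E; ring.
  by move=> [n ->]; rewrite gerBl.
Qed.

Lemma int_tail_le (k : int) :
  (phi `]((2 : R) ^ k), +oo[%classic <= (2 ^ (- k))%:E)%E.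
Proof.
have k0 : (0 : R) <= 2 ^ (- (k + 1)) by rewrite exprz_ge0.
rewrite -[X in (X <= _)%E]mul1e -integral_cst//.
(* The interval is open at 2^k, so its first atom is 2^(k+1). *)
rewrite (@integral_dyadic (fun n => (k + 1) + n%:Z))//.
- apply: le_trans (_ : _ <= (2 * 2 ^ (- (k + 1)))%:E)%E _.
    apply: le_trans _ (half_series_le k0); apply: lee_nneseries => n *.
      by rewrite mule1 lee_fin exprz_ge0.
    by rewrite mule1 lee_fin opprD exprzBn.
  by rewrite lee_fin opprD expfzDr// mulrCA divff// mulr1.
- by move=> i j /addrI[].
- move=> j; rewrite /= in_itv/= andbT ltr_eXz2l ?ltr1n//; split.
    rewrite -lezD1 -subr_ge0; case E : (j - (k + 1)) => [n|//] _; exists n; rewrite -E; ring.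
  by move=> [n ->]; rewrite -lezD1 lerDl.
Qed.

(** The integrability condition on a Lévy measure. Splitting at 1 = 2^0 leaves the two geometric
    series bounded above. Integrability of the integrands of [psi_re] and [psi_im] follows by
    domination. *)
Lemma integrable_min1sqr :
  phi.-integrable `]0%R, +oo[ (fun x : R => (Num.min 1 (x ^+ 2))%:E).
Proof.
have mm : measurable_fun [set: measurableTypeR R] (fun x : R => (Num.min 1 (x ^+ 2))%:E).
  apply/measurable_EFinP; apply: measurable_minr; first exact: measurable_cst.
  exact: exprn_measurable.
have m0 (x : R) : 0 <= Num.min 1 (x ^+ 2) by rewrite le_min ler01 sqr_ge0.
apply/integrableP; split; first by apply: measurable_funS mm.
have -> : `]0%R, +oo[%classic = `]0%R, (2 : R) ^ 0]%classic `|` `](2 : R) ^ 0, +oo[%classic :> set R.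
  by rewrite -itv_bndbnd_setU// ?bnd_simp.
rewrite ge0_integral_setU//; last 2 first.
  by apply: measurable_funS (measurableT_comp _ mm).
  apply/disj_set2P/seteqP; split => // x /=; rewrite !in_itv/= andbT => -[/andP[_ x1]].
  by rewrite ltNge x1.
apply: lte_add_pinfty.
  apply: le_lt_trans (ltry (2 * 2 ^ (0 : int))).
  apply: le_trans (int_sqr_le _); apply: ge0_le_integral => //.
  - by apply: measurable_funS (measurableT_comp _ mm).
  - by apply/measurable_EFinP; apply: measurable_funTS; exact: exprn_measurable.
  - by move=> x _; rewrite lee_fin ger0_norm// ge_min lexx orbT.
apply: le_lt_trans (ltry (2 ^ (- (0 : int)))).
apply: le_trans (int_tail_le _); rewrite -[leRHS]mul1e -integral_cst//; apply: ge0_le_integral => //.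
- by apply: measurable_funS (measurableT_comp _ mm).
- by move=> x _; rewrite lee_fin ger0_norm// ge_min lexx.
Qed.

End LevyExponent.

(** * Semistability of the characteristic exponent *)

Section ExponentScaling.
Context {R : realType} (phi : {measure set (measurableTypeR R) -> \bar R}).
Hypothesis phiP : st_petersburg_levy_measure phi.

Lemma measurable_cosM (y : R) D : measurable_fun D (fun x : measurableTypeR R => cos (y * x)).
Proof.
apply: measurable_funTS; apply: continuous_measurable_fun => x.
by apply: (continuous_comp (@mulrl_continuous _ y x)); exact: continuous_cos.
Qed.

Lemma measurable_sinM (y : R) D : measurable_fun D (fun x : measurableTypeR R => sin (y * x)).
Proof.
apply: measurable_funTS; apply: continuous_measurable_fun => x.
by apply: (continuous_comp (@mulrl_continuous _ y x)); exact: continuous_sin.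
Qed.

Lemma measurable_lei (c : R) D : measurable_fun D (fun x : measurableTypeR R => (x <= c)%R%:R : R).
Proof.
rewrite (_ : (fun x => _) = \1_(`]-oo, c]%classic : set (measurableTypeR R))).
  exact: measurable_indic.
by apply/funext => x; rewrite indicE mem_setE in_itv/=.
Qed.

Lemma integrable_dominated (f : R -> R) (C : R) :
  measurable_fun [set: measurableTypeR R] f ->
  (forall x, 0 < x -> `|f x| <= C * Num.min 1 (x ^+ 2)) ->
  phi.-integrable `]0%R, +oo[ (EFin \o f).
Proof.
move=> mf fC; apply: le_integrable (integrableZl _ C (integrable_min1sqr phiP)) => //.
  by apply/measurable_EFinP; exact: measurable_funTS.
move=> x /=; rewrite in_itv/= andbT => x0; rewrite lee_fin.
by apply: le_trans (fC x x0) (ler_norm _).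
Qed.

Lemma integrable_psi_re (y : R) :
  phi.-integrable `]0%R, +oo[ (EFin \o (fun x : R => cos (y * x) - 1)).
Proof.
apply: (@integrable_dominated _ (2 + y ^+ 2)).
  apply: measurable_funB; last exact: measurable_cst.
  exact: measurable_cosM.
move=> x x0; rewrite distrC ger0_norm ?subr_ge0 ?cos_le1//.
have := subr1_cos_le_sqr (y * x); have := cos_geN1 (y * x).
rewrite minEle exprMn; have := sqr_ge0 y; have := sqr_ge0 x.
by case: ifP => _; [lra|nra].
Qed.

Lemma integrable_psi_im (y : R) :
  phi.-integrable `]0%R, +oo[ (EFin \o (fun x : R => sin (y * x) - y * x * (x <= 1)%R%:R)).
Proof.
apply: (@integrable_dominated _ (1 + y ^+ 2)).
  apply: measurable_funB; first exact: measurable_sinM.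
  by apply: measurable_funM; [exact: mulrl_measurable|exact: measurable_lei].
move=> x x0; have [x1|x1] := leP x 1.
  rewrite mulr1; apply: le_trans (norm_sinB_le _) _.
  have : x ^+ 2 <= 1 by rewrite expr_le1// ltW.
  rewrite exprMn => /min_idPr ->; apply: ler_wpM2r; rewrite ?sqr_ge0//; lra.
rewrite mulr0 subr0; apply: le_trans (sin_max _) _.
have : 1 <= x ^+ 2 by rewrite expr_ge1// ltW.
by move=> /min_idPl ->; rewrite mulr1 lerDl sqr_ge0.
Qed.

Lemma Rintegral_double (f : R -> R) :
  measurable_fun [set: measurableTypeR R] f ->
  phi.-integrable `]0%R, +oo[ (EFin \o f) ->
  phi.-integrable `]0%R, +oo[ (EFin \o (fun x : R => f (2 * x))) ->
  (\int[phi]_(x in `]0%R, +oo[) f (2 * x) = 2 * \int[phi]_(x in `]0%R, +oo[) f x)%R.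
Proof.
move=> mf if1 if2.
pose g : measurableTypeR R -> measurableTypeR R := fun x : R => 2 * x.
have mg : measurable_fun setT g by exact: mulrl_measurable.
have gD : g @^-1` `]0%R, +oo[%classic = `]0%R, +oo[%classic.
  by apply/seteqP; split => x /=; rewrite !in_itv/= !andbT /g pmulr_rgt0.
have mD : measurable (`]0%R, +oo[%classic : set (measurableTypeR R)) by [].
have mEf : measurable_fun [set: measurableTypeR R] (EFin \o f) by exact/measurable_EFinP.
have := @integral_pushforward _ _ _ _ _ g mg phi `]0%R, +oo[%classic (EFin \o f) mEf.
rewrite gD => /(_ if2 mD) E.
(* By [phi_double] the image of [phi] under doubling is twice [phi], written as [phi + phi] so that
   additivity of the integral in the measure applies. *)
have E2 : (\int[pushforward phi g]_(y in `]0%R, +oo[) (EFin \o f) y =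
    \int[measure_add phi phi]_(y in `]0%R, +oo[) (EFin \o f) y)%E.
  apply: eq_measure_integral => A mA _.
  rewrite /measure_add/= /msum 2!big_ord_recl/= big_ord0 adde0 -[RHS]mule2n -mule_natl; exact: (phi_double phiP mA).
rewrite /Rintegral -[X in fine X = _]E E2.
rewrite integral_measure_add//.
by rewrite fineD ?mulr_natl//; exact: integrable_fin_num.
Qed.

Lemma psi_re_double (y : R) : psi_re phi (2 * y) = 2 * psi_re phi y.
Proof.
rewrite /psi_re -Rintegral_double.
- by apply: eq_Rintegral => x _; rewrite mulrCA mulrA.
- apply: measurable_funB; last exact: measurable_cst.
  exact: measurable_cosM.
- exact: integrable_psi_re.
- have := integrable_psi_re (2 * y).
  by apply: eq_integrable => // x _ /=; rewrite mulrCA mulrA.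
Qed.

(** The integrand is x on ]1, 2] and 0 elsewhere. The only atom in that interval is 2, of mass
    1/2. *)
Lemma Rintegral_itv12 :
  (\int[phi]_(x in `]0%R, +oo[) (x * ((x <= 2)%R%:R - (x <= 1)%R%:R)) = 1)%R.
Proof.
have m12 : measurable (`]1, 2]%classic : set (measurableTypeR R)) by [].
rewrite /Rintegral (_ : integral _ _ _ = 1%E)//.
transitivity (\int[phi]_(x in `]0%R, +oo[ `&` [set` `]1%R, 2%R]]) (x%:E : \bar R))%E.
  rewrite integral_mkcondr; apply: eq_integral => x _; rewrite patchE mem_setE in_itv/=.
  rewrite ltNge; have [x1|x1] := leP x 1; rewrite /= ?(le_trans x1) ?ler1n// ?subrr ?mulr0//.
  by case: (x <= 2); rewrite ?subr0 ?mulr1 ?mulr0.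
have -> : `]0, +oo[ `&` [set` `]1, 2]] = `]1, 2]%classic :> set R.
  by apply/setIidPr => x /=; rewrite !in_itv/= andbT => /andP[x1 _]; rewrite (lt_trans _ x1).
rewrite (@ge0_negligible_integral _ _ _ phi _ `]1, 2[%classic)//.
- rewrite (_ : [set` `]1, 2]] `\` [set` `]1, 2[] = [set (2 : R)]); last first.
    apply/seteqP; split => x /=; rewrite !in_itv/=; last by move=> ->; rewrite ltxx ltr1n lexx.
    move=> [/andP[x1 x2] /negP]; rewrite x1/= -leNgt => x2'.
    by apply/eqP; rewrite eq_le x2 x2'.
  rewrite (eq_integral (cst (2%:E))); last by move=> x; rewrite inE => ->.
  rewrite integral_cst//.
  have := phiP.2 1; rewrite expr1z => H.
  transitivity (2%:E * (2 ^ (-1))%:E : \bar R)%E; first by congr (_ * _)%E.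
  by rewrite -EFinM divff.
- by move=> x /=; rewrite in_itv/= lee_fin => /andP[x1 _]; rewrite ltW// (lt_trans _ x1).
- apply/eqP; rewrite eq_le measure_ge0 andbT.
  have mD : measurable [set (2 : R) ^ k | k in [set: int]].
    by apply: countable_measurable => //; exact: countable_dyadic.
  have <- : phi (~` [set (2 : R) ^ k | k in [set: int]]) = 0%E := phiP.1.
  apply: le_measure; rewrite ?inE//; first exact: measurableC.
  move=> x /=; rewrite in_itv/= => /andP[x1 x2] [k _ E].
  have k0 : (0 < k)%R by rewrite -(@ltr_eXz2l R 2) ?ltr1n// expr0z E.
  have k1 : (k < 1)%R by rewrite -(@ltr_eXz2l R 2) ?ltr1n// expr1z E.
  by case: k k0 k1 {E} => // -[|n].
Qed.

(* The drift - 2 * y comes from the atom at 2, which rescaling by 2 brings below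
   the truncation level 1. *)
Lemma psi_im_double (y : R) : psi_im phi (2 * y) = 2 * psi_im phi y - 2 * y.
Proof.
pose h (x : R) : R := x * ((x <= 2)%R%:R - (x <= 1)%R%:R).
have ih : phi.-integrable `]0%R, +oo[ (EFin \o h).
  apply: (@integrable_dominated _ 2).
    apply: measurable_funM; first exact: measurable_id.
    by apply: measurable_funB; exact: measurable_lei.
  move=> x x0; rewrite /h; have [x1|x1] := leP x 1.
    rewrite (le_trans x1) ?ler1n// subrr mulr0 normr0.
    by rewrite mulr_ge0// le_min ler01 sqr_ge0.
  have : 1 <= x ^+ 2 by rewrite expr_ge1// ltW.
  move=> /min_idPl ->; have [x2|x2] := leP x 2; rewrite ?subr0 ?subrr ?mulr1 ?mulr0 ?normr0//.
  by rewrite ger0_norm// ltW.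
have iyh : phi.-integrable `]0%R, +oo[ (EFin \o (fun x => y * h x)).
  by have := integrableZl _ y ih; apply.
(* With the cutoff at 2, [f (2 * x)] is the integrand of [psi_im (2 * y)]. Moving the cutoff back to
   1 costs [y * h]. *)
pose f (x : R) := sin (y * x) - y * x * (x <= 2)%R%:R.
have fE : f = (fun x : R => (sin (y * x) - y * x * (x <= 1)%R%:R) - y * h x).
  by apply/funext => x; rewrite /f /h; ring.
have -> : psi_im phi (2 * y) = (\int[phi]_(x in `]0%R, +oo[) f (2 * x))%R.
  apply: eq_Rintegral => x _; rewrite /f mulrCA mulrA; congr (_ - _ * (nat_of_bool _)%:R).
  by rewrite -[X in _ = (_ <= X)]mulr1 ler_pM2l.
rewrite Rintegral_double; last 3 first.
- rewrite /f; apply: measurable_funB; first exact: measurable_sinM.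
  by apply: measurable_funM; [exact: mulrl_measurable|exact: measurable_lei].
- by rewrite fE; exact: (integrableB _ (integrable_psi_im y) iyh).
- have := integrable_psi_im (2 * y).
  apply: eq_integrable => // x _ /=; rewrite /f mulrCA mulrA; congr (_ - _ * (nat_of_bool _)%:R)%:E.
  by rewrite -[X in _ = (_ <= X)]mulr1 ler_pM2l.
rewrite fE RintegralB//; last exact: integrable_psi_im.
rewrite RintegralZl// [X in _ - y * X]Rintegral_itv12 /psi_im; ring.
Qed.

Lemma psi_re_pow (y : R) n : psi_re phi (2 ^+ n * y) = 2 ^+ n * psi_re phi y.
Proof.
elim: n => [|n IH]; first by rewrite !mul1r.
by rewrite exprS -mulrA psi_re_double IH mulrA.
Qed.

Lemma psi_im_pow (y : R) n :
  psi_im phi (2 ^+ n * y) = 2 ^+ n * (psi_im phi y - n%:R * y).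
Proof.
elim: n => [|n IH]; first by rewrite !mul1r mul0r subr0.
by rewrite exprS -mulrA psi_im_double IH -natr1; ring.
Qed.

End ExponentScaling.

(** * Uniform tails of the rescaled marginals and steep descent *)

Section MarginalLaws.
Context {R : realType} d {T : measurableType d} (P : probability T R).
Context (phi : {measure set (measurableTypeR R) -> \bar R}) (X : R -> T -> R).
Hypothesis phiP : st_petersburg_levy_measure phi.
Hypothesis mX : forall t, 0 <= t -> measurable_fun setT (X t).
Hypothesis charX : forall t y : R, 0 <= t ->
  char_fun P (X t) y = cexp (t%:C * levy_exponent phi y).

Lemma integrable_bounded_comp (f : R -> R) (M : R) t : 0 <= t ->
  measurable_fun setT f -> (forall x, `|f x| <= M) ->
  P.-integrable setT (EFin \o (fun w => f (X t w))).
Proof.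
move=> t0 mf fM; apply: measurable_bounded_integrable => //.
- by apply: (@le_lt_trans _ _ 1%E); [exact: probability_le1|exact: ltry].
- by apply: measurableT_comp => //; exact: mX.
- by exists M; split; [exact: num_real|move=> r Mr w _; exact: le_trans (fM _) (ltW Mr)].
Qed.

Lemma measurable_cos_affine (y b : R) : measurable_fun setT (fun x : R => cos (y * x + b)).
Proof.
apply: continuous_measurable_fun => x.
apply: (@continuous_comp _ _ _ (fun x : R => y * x + b)); last exact: continuous_cos.
by apply: cvgD; [exact: mulrl_continuous|exact: cvg_cst].
Qed.

(** The real part of e^(ib) times the characteristic function. The phase [b] serves the centring of
    [Z m] and the shifted cosines of the test functions. *)
Lemma expectation_cos (t y b : R) : 0 <= t ->
  (\int[P]_w cos (y * X t w + b) =
   expR (t * psi_re phi y) * cos (t * psi_im phi y + b))%R.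
Proof.
move=> t0; have := charX y t0.
rewrite /char_fun /cintegral levy_exponentE /cexp/=.
rewrite !(mul0r, mul1r, mulr0, subr0, sub0r, addr0, add0r, oppr0).
pose simp := (mul0r, mul1r, mulr0, subr0, sub0r, addr0, add0r, oppr0, expR0).
under eq_Rintegral do rewrite !simp.
under [X in _ +i* X]eq_Rintegral do rewrite !simp.
move=> E; have := congr1 (@complex.Im R) E; have := congr1 (@complex.Re R) E.
rewrite /= !simp => Ec Es.
have ic : P.-integrable setT (EFin \o (fun w => cos (y * X t w))).
  apply: (@integrable_bounded_comp (fun x => cos (y * x)) 1 t t0); first exact: measurable_cosM.
  by move=> x; exact: cos_max.
have is_ : P.-integrable setT (EFin \o (fun w => sin (y * X t w))).
  apply: (@integrable_bounded_comp (fun x => sin (y * x)) 1 t t0); first exact: measurable_sinM.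
  by move=> x; exact: sin_max.
under eq_Rintegral do rewrite cosD.
rewrite RintegralB//; last 2 first.
- by have := integrableZr measurableT (cos b) ic; apply.
- by have := integrableZr measurableT (sin b) is_; apply.
rewrite !RintegralZr// Ec Es cosD; ring.
Qed.

Lemma markov_set (f : T -> R) (c : R) (S : set T) : measurable S ->
  P.-integrable setT (EFin \o f) -> (forall w, 0 <= f w) ->
  (forall w, S w -> c <= f w) ->
  (c%:E * P S <= (\int[P]_w f w)%R%:E)%E.
Proof.
move=> mS If f0 Sf.
rewrite /Rintegral fineK; last exact: integrable_fin_num.
rewrite -integral_cst//; apply: (@le_trans _ _ (\int[P]_(w in S) (f w)%:E)%E).
  apply: le_integral => //.
  - by apply: finite_measure_integrable_cst.
  - by apply: integrableS If.
  - by move=> w; rewrite inE => /Sf; rewrite lee_fin.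
apply: ge0_subset_integral => //; first by case/integrableP : If.
by move=> w _; rewrite lee_fin.
Qed.

Lemma psi_re_le0 y : psi_re phi y <= 0.
Proof.
have i := integrable_psi_re phiP y.
have : 0 <= (\int[phi]_(x in `]0%R, +oo[) ((-1) * (cos (y * x) - 1)))%R.
  by apply: Rintegral_ge0 => x _; rewrite mulN1r oppr_ge0 subr_le0 cos_le1.
by rewrite RintegralZl// mulN1r oppr_ge0.
Qed.

(** The summand 2 absorbs the linear term in [char_defect_bound], through j <= 2 (3/2)^j. *)
Definition psi_bound := `|psi_re phi 1| + `|psi_im phi 1| + 2.

(** The left side is at most |psi_re| + |psi_im| at 2^(-j). By semistability this is 2^(-j) times a
    constant plus j, and a rate 3/4 instead of 1/2 pays for the factor j. *)
Lemma char_defect_bound j :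
  1 - expR (psi_re phi (2 ^- j)) * cos (psi_im phi (2 ^- j)) <= psi_bound * (3 / 4) ^+ j.
Proof.
have p0 : 0 < (2 : R) ^+ j by rewrite exprn_gt0.
have rE : psi_re phi (2 ^- j) = 2 ^- j * psi_re phi 1.
  by have := psi_re_pow phiP (2 ^- j) j; rewrite divff ?gt_eqF// => ->; rewrite mulKf ?gt_eqF.
have iE : psi_im phi (2 ^- j) = 2 ^- j * (psi_im phi 1 + j%:R).
  have := psi_im_pow phiP (2 ^- j) j; rewrite divff ?gt_eqF// => ->.
  by rewrite mulrDr mulKf ?gt_eqF//; ring.
have h0 : 0 <= (2 : R) ^- j by rewrite invr_ge0 ltW.
have j34 : 2 ^- j * (`|psi_re phi 1| + `|psi_im phi 1| + j%:R) <= psi_bound * (3 / 4) ^+ j.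
  have -> : (3 / 4 : R) ^+ j = 2 ^- j * (3 / 2) ^+ j.
    by rewrite -exprVn -exprMn; congr (_ ^+ _); lra.
  rewrite [leRHS]mulrCA ler_wpM2l// /psi_bound.
  have B : 1 + j%:R / 2 <= (3 / 2 : R) ^+ j.
    elim: (j) => [|i IH]; first by rewrite mul0r addr0.
    by rewrite exprS -natr1; have : 0 <= i%:R :> R by []; lra.
  have := normr_ge0 (psi_re phi 1); have := normr_ge0 (psi_im phi 1).
  have : 0 <= j%:R :> R by []. nra.
apply: le_trans j34.
have r0 := psi_re_le0 (2 ^- j).
have e1 : expR (psi_re phi (2 ^- j)) <= 1 by rewrite -[leRHS]expR0 ler_expR.
have e2 := expR_ge1Dx (psi_re phi (2 ^- j)).
have c1 := subr1_cos_le_norm (psi_im phi (2 ^- j)).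
have c2 := cos_le1 (psi_im phi (2 ^- j)).
have n1 : `|psi_im phi (2 ^- j)| <= 2 ^- j * (`|psi_im phi 1| + j%:R).
  by rewrite iE normrM (ger0_norm h0) ler_wpM2l// (le_trans (ler_normD _ _))// normr_nat.
have n2 : - psi_re phi (2 ^- j) <= 2 ^- j * `|psi_re phi 1|.
  by rewrite rE -mulrN ler_wpM2l// -normrN ler_norm.
by rewrite -addrA mulrDr; nra.
Qed.

(* By semistability the characteristic function of Z m does not depend on m. *)
Let Z m w := 2 ^+ m * X (2 ^- m) w + m%:R.

Let mZ m : measurable_fun setT (Z m).
Proof.
apply: measurable_funD; last exact: measurable_cst.
by apply: measurable_funM; [exact: measurable_cst|apply: mX; rewrite invr_ge0 exprn_ge0].
Qed.

(** Markov's inequality for 1 - cos (2^(-j) Z): on the band the argument has modulus in [1, 2],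
    where 1 - cos is at least 1 - cos 1 because 2 <= pi. *)
Lemma band_bound m j :
  (P [set w | (2 ^+ j <= `|Z m w| <= 2 ^+ j.+1)%R] <=
   (psi_bound / (1 - cos 1) * (3 / 4) ^+ j)%:E)%E.
Proof.
have pj : 0 < (2 : R) ^+ j by rewrite exprn_gt0.
have pm : 0 < (2 : R) ^+ m by rewrite exprn_gt0.
have hm : 0 <= (2 : R) ^- m by rewrite invr_ge0 ltW.
have k0 : 0 < 1 - cos 1 :> R by rewrite subr_gt0 cos1_lt1.
have mS : measurable [set w | 2 ^+ j <= `|Z m w| <= 2 ^+ j.+1].
  rewrite (_ : [set w | _] = setT `&` (fun w => `|Z m w|) @^-1` `[2 ^+ j, 2 ^+ j.+1]).
    by apply: (measurableT_comp _ (mZ m)).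
  by rewrite setTI; apply/seteqP; split => w /=; rewrite in_itv.
pose f w := 1 - cos (2 ^- j * Z m w).
have fE w : f w = 1 - cos ((2 ^+ m * 2 ^- j) * X (2 ^- m) w + 2 ^- j * m%:R).
  by rewrite /f /Z; congr (1 - cos _); ring.
have ic : P.-integrable setT
    (EFin \o (fun w => cos ((2 ^+ m * 2 ^- j) * X (2 ^- m) w + 2 ^- j * m%:R))).
  apply: (@integrable_bounded_comp (fun x => cos ((2 ^+ m * 2 ^- j) * x + 2 ^- j * m%:R)) 1) => //.
    exact: measurable_cos_affine.
  by move=> x; exact: cos_max.
have i1 : P.-integrable setT (EFin \o (fun=> 1 : R)) by exact: finite_measure_integrable_cst.
have If : P.-integrable setT (EFin \o f).
  rewrite (_ : f = (fun w => 1 - cos ((2 ^+ m * 2 ^- j) * X (2 ^- m) w + 2 ^- j * m%:R))); last first.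
    exact/funext.
  exact: (integrableB _ i1 ic).
have Ef : (\int[P]_w f w)%R = 1 - expR (psi_re phi (2 ^- j)) * cos (psi_im phi (2 ^- j)).
  under eq_Rintegral do rewrite fE.
  rewrite RintegralB// Rintegral_cst// (_ : 1 * _ = 1 :> R); last first.
    by rewrite mul1r; exact: (congr1 fine (@probability_setT _ T R P)).
  rewrite expectation_cos//.
  (* The time 2^(-m) cancels the factor 2^m from scaling the exponent, and the phase 2^(-j) m
     cancels the drift in [psi_im_pow]. *)
  congr (1 - expR _ * cos _).
    by rewrite (psi_re_pow phiP) mulKf// gt_eqF.
  by rewrite (psi_im_pow phiP) mulKf ?gt_eqF//; ring.
have := @markov_set f (1 - cos 1) _ mS If.
rewrite Ef => H.
rewrite mulrAC mulrC EFinM lee_pdivlMl//.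
apply: le_trans (H _ _) _.
- by move=> w; rewrite subr_ge0 cos_le1.
- move=> w /= /andP[z1 z2]; rewrite /f lerB//.
  have p2 := @pi_ge2 R.
  rewrite -cos_norm normrM gtr0_norm ?invr_gt0//; apply: cos_antitone => //.
    by rewrite ler_pdivlMl// mulr1.
  by apply: le_trans p2; rewrite ler_pdivrMl// -exprSr.
- by rewrite lee_fin; exact: char_defect_bound.
Qed.

Let geom34 n : \sum_(0 <= i < n) (3 / 4 : R) ^+ i <= 4.
Proof.
suff -> : \sum_(0 <= i < n) (3 / 4 : R) ^+ i = 4 - 4 * (3 / 4) ^+ n.
  by rewrite gerBl mulr_ge0// exprn_ge0//; lra.
elim: n => [|n IH]; first by rewrite big_geq// expr0; ring.
by rewrite big_nat_recr//= IH exprS; field.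
Qed.

(** The tail is a union of dyadic bands, whose bounds form a geometric series. The point is that the
    bound does not depend on [m]. *)
Lemma tail_bound m J :
  (P [set w | (2 ^+ J <= `|Z m w|)%R] <=
   (psi_bound / (1 - cos 1) * (3 / 4) ^+ J * 4)%:E)%E.
Proof.
have mZn := measurableT_comp (@normr_measurable R setT) (mZ m).
have mS : measurable [set w | 2 ^+ J <= `|Z m w|].
  rewrite (_ : [set w | _] = setT `&` (fun w => `|Z m w|) @^-1` `[2 ^+ J, +oo[).
    exact: mZn.
  by rewrite setTI; apply/seteqP; split => w /=; rewrite in_itv/= andbT.
have mSj j : measurable [set w | 2 ^+ j <= `|Z m w| <= 2 ^+ j.+1].
  rewrite (_ : [set w | _] = setT `&` (fun w => `|Z m w|) @^-1` `[2 ^+ j, 2 ^+ j.+1]).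
    exact: mZn.
  by rewrite setTI; apply/seteqP; split => w /=; rewrite in_itv.
have C0 : 0 <= psi_bound / (1 - cos 1).
  by apply: divr_ge0; [rewrite !addr_ge0|rewrite subr_ge0 cos_le1].
apply: (@le_trans _ _ (\sum_(0 <= j <oo) P [set w | (2 ^+ (J + j) <= `|Z m w| <= 2 ^+ (J + j).+1)%R])%E).
  apply: measure_sigma_subadditive => // w /= Jw.
  have ex : exists n, `|Z m w| < 2 ^+ n.
    exists (Num.bound `|Z m w|); apply: lt_trans (archi_boundP (normr_ge0 _)) _.
    by rewrite -natrX ltr_nat ltn_expl.
  case: (ex_minnP ex) => -[|n] nw minn.
    move: Jw; rewrite leNgt; apply: contraNP => _; apply: lt_le_trans nw _.
    by rewrite expr0 exprn_ege1// ler1n.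
  have nw' : 2 ^+ n <= `|Z m w|.
    by rewrite leNgt; apply/negP => /minn; rewrite ltnn.
  have Jn : (J <= n)%N.
    have := le_lt_trans Jw nw; rewrite ltr_eXn2l ?ltr1n//.
  by exists (n - J)%N => //=; rewrite subnKC// nw' ltW.
apply: (@le_trans _ _ (\sum_(0 <= j <oo) (psi_bound / (1 - cos 1) * (3 / 4) ^+ J * (3 / 4) ^+ j)%:E)%E).
  apply: lee_nneseries => j *; first exact: measure_ge0.
  by rewrite -mulrA -exprD; exact: band_bound.
have q0 j : 0 <= (3 / 4 : R) ^+ j by rewrite exprn_ge0//; lra.
apply: lime_le.
  apply: is_cvg_nneseries => n _ _; by rewrite lee_fin; do 2 apply: mulr_ge0 => //.
apply: nearW => n; rewrite sumEFin lee_fin -mulr_sumr ler_wpM2l// mulr_ge0//.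
Qed.

(** The event says that [Z m >= m - K]. Choose [J] so that the tail beyond 2^J is at most [e] for
    all [m], then [m] larger than 2^J + |K|. *)
Lemma steep_descent (K e : R) : 0 < e -> exists2 m, (0 < m)%N &
  (P [set w | (- K * 2 ^- m <= X (2 ^- m) w)%R] <= e%:E)%E.
Proof.
move=> e0; set B := psi_bound / (1 - cos 1).
have [J BJ] : exists J, B * (3 / 4) ^+ J * 4 <= e.
  have : (fun n => B * 4 * (3 / 4) ^+ n) @ \oo --> 0.
    by apply: cvg_geometric; rewrite ger0_norm; lra.
  move=> /cvgr_le /(_ e e0)[N _ HN]; exists N.
  by have := HN N (leqnn N); rewrite mulrAC.
have [m mJ] : exists m : nat, 2 ^+ J + `|K| < m%:R.
  exists (Num.bound (2 ^+ J + `|K|)); apply: archi_boundP.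
  by rewrite addr_ge0// exprn_ge0.
have p0 : 0 < (2 : R) ^+ m by rewrite exprn_gt0.
exists m.
  by rewrite -(ltr_nat R); apply: le_lt_trans mJ; rewrite addr_ge0// exprn_ge0.
have hm : 0 <= (2 : R) ^- m by rewrite invr_ge0 ltW.
apply: le_trans (le_trans (tail_bound m J) _); last by rewrite lee_fin.
apply: le_measure; rewrite ?inE.
- rewrite (_ : [set w | _] = setT `&` X (2 ^- m) @^-1` `[- K * 2 ^- m, +oo[).
    exact: mX.
  by rewrite setTI; apply/seteqP; split => w /=; rewrite in_itv/= andbT.
- rewrite (_ : [set w | _] = setT `&` (fun w => `|Z m w|) @^-1` `[2 ^+ J, +oo[).
    exact: (measurableT_comp (@normr_measurable R setT) (mZ m)).
  by rewrite setTI; apply/seteqP; split => w /=; rewrite in_itv/= andbT.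
- move=> w /= Hw; apply: le_trans (ler_norm _).
  rewrite /Z; have : - K <= 2 ^+ m * X (2 ^- m) w by rewrite mulrC -ler_pdivrMr.
  have := ler_norm K; lra.
Qed.

End MarginalLaws.

(** * The generator at 0 on trigonometric polynomials, and small negative increments *)

Section Generator.
Context {R : realType} d {T : measurableType d} (P : probability T R).
Context (phi : {measure set (measurableTypeR R) -> \bar R}) (X : R -> T -> R).
Hypothesis phiP : st_petersburg_levy_measure phi.
Hypothesis mX : forall t, 0 <= t -> measurable_fun setT (X t).
Hypothesis charX : forall t y : R, 0 <= t ->
  char_fun P (X t) y = cexp (t%:C * levy_exponent phi y).

Definition compensated (f : R -> R) (D x : R) := f x - f 0 - D * x * (x <= 1)%R%:R.

(** [D] is f'(0), and [gen_limit] is the generator formula at 0 along the times 1/(n+1). Boundedness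
    provides expectations, and derivability everywhere allows the minimum test that identifies
    [D]. *)
Record generator_at (f : R -> R) (D : R) : Prop := {
  gen_measurable : measurable_fun setT f ;
  gen_bounded : exists M, forall x, `|f x| <= M ;
  gen_derivable : forall x, derivable f x 1 ;
  gen_derive : is_derive (0 : R) (1 : R) f D ;
  gen_integrable : phi.-integrable `]0%R, +oo[ (EFin \o compensated f D) ;
  gen_limit : (fun n => n.+1%:R * ((\int[P]_w f (X n.+1%:R^-1 w))%R - f 0)) @ \oo -->
    (\int[phi]_(x in `]0%R, +oo[) compensated f D x)%R }.

Let invn0 n : 0 <= (n.+1%:R^-1 : R). Proof. by rewrite invr_ge0. Qed.

Lemma gen_integrableP f D n : generator_at f D ->
  P.-integrable setT (EFin \o (fun w => f (X n.+1%:R^-1 w))).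
Proof. by move=> [mf [M fM] _ _ _ _]; apply: (integrable_bounded_comp P mX _ mf fM). Qed.

Lemma generator_at_add f g D E : generator_at f D -> generator_at g E ->
  generator_at (fun x => f x + g x) (D + E).
Proof.
move=> Gf Gg.
have [mf [M fM] df Df If Lf] := Gf; have [mg [N gN] dg Dg Ig Lg] := Gg.
have cE : compensated (fun x => f x + g x) (D + E) =
    (fun x => compensated f D x + compensated g E x).
  by apply/funext => x; rewrite /compensated; ring.
split.
- exact: measurable_funD.
- by exists (M + N) => x; rewrite (le_trans (ler_normD _ _))// lerD.
- by move=> x; exact: derivableD.
- exact: is_deriveD.
- by rewrite cE; exact: (integrableD _ If Ig).
- rewrite cE RintegralD//.
  rewrite (_ : (fun n => _) = (fun n => n.+1%:R * ((\int[P]_w f (X n.+1%:R^-1 w))%R - f 0) +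
    n.+1%:R * ((\int[P]_w g (X n.+1%:R^-1 w))%R - g 0))); first exact: cvgD.
  by apply/funext => n; rewrite RintegralD//; [ring|exact: gen_integrableP Gf|exact: gen_integrableP Gg].
Qed.

Lemma generator_at_scale f D c : generator_at f D ->
  generator_at (fun x => c * f x) (c * D).
Proof.
move=> Gf; have [mf [M fM] df Df If Lf] := Gf.
have cE : compensated (fun x => c * f x) (c * D) = (fun x => c * compensated f D x).
  by apply/funext => x; rewrite /compensated; ring.
split.
- by apply: measurable_funM => //; exact: measurable_cst.
- by exists (`|c| * M) => x; rewrite normrM ler_wpM2l.
- by move=> x; apply: (@derivableZ _ _ _ f c).
- exact: (@is_deriveZ _ _ _ f c).
- by rewrite cE; have := integrableZl _ c If; apply.
- rewrite cE RintegralZl//.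
  rewrite (_ : (fun n => _) = (fun n => c * (n.+1%:R * ((\int[P]_w f (X n.+1%:R^-1 w))%R - f 0)))).
    by apply: cvgM => //; exact: cvg_cst.
  by apply/funext => n; rewrite RintegralZl//; [ring|exact: gen_integrableP Gf].
Qed.

Lemma is_derive_cvg_harmonic (g : R -> R) (D : R) : is_derive (0 : R) (1 : R) g D ->
  (fun n => n.+1%:R * (g n.+1%:R^-1 - g 0)) @ \oo --> D.
Proof.
move=> [dg <-].
have h : (fun n => n.+1%:R^-1 : R) @ \oo --> (0 : R)^'.
  move=> A; rewrite near_simpl /= => -[e /= e0 He].
  have := @cvg_harmonic R => /cvgrPdist_lt /(_ e e0)[N _ HN].
  by exists N => // n Nn; apply: He; [exact: HN|rewrite invr_eq0 pnatr_eq0].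
have := cvg_comp _ _ h dg.
apply: cvg_trans; apply: near_eq_cvg; apply: nearW => n /=.
by rewrite invrK addr0 /GRing.scale/= mulr1.
Qed.

Lemma is_derive_cos_affine (y b x : R) :
  is_derive x (1 : R) (fun z => cos (y * z + b)) (- (y * sin (y * x + b))).
Proof.
have a : is_derive x (1 : R) (fun z : R => y * z + b) y.
  rewrite -[X in is_derive _ _ _ X]addr0; apply: is_deriveD.
  rewrite -[X in is_derive _ _ _ X]mulr1; exact: (@is_deriveZ _ _ _ id y).
have := @is_derive1_comp R cos (fun z => y * z + b) x _ _ (is_derive_cos (y * x + b)) a.
by rewrite mulNr mulrC.
Qed.

(** [expectation_cos] gives the expectation in closed form as a function of time. Its derivative at
    0 is psi_re cos b - psi_im sin b, which is the compensated integral expanded by the addition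
    formula. *)
Lemma generator_at_cos (y b : R) :
  generator_at (fun x => cos (y * x + b)) (- (y * sin b)).
Proof.
have cE : compensated (fun x => cos (y * x + b)) (- (y * sin b)) = (fun x =>
    cos b * (cos (y * x) - 1) - sin b * (sin (y * x) - y * x * (x <= 1)%R%:R)).
  by apply/funext => x; rewrite /compensated cosD mulr0 add0r; ring.
have i1 : phi.-integrable `]0%R, +oo[ (EFin \o (fun x => cos b * (cos (y * x) - 1))).
  by have := integrableZl _ (cos b) (integrable_psi_re phiP y); apply.
have i2 : phi.-integrable `]0%R, +oo[
    (EFin \o (fun x => sin b * (sin (y * x) - y * x * (x <= 1)%R%:R))).
  by have := integrableZl _ (sin b) (integrable_psi_im phiP y); apply.
split.
- exact: measurable_cos_affine.
- by exists 1 => x; exact: cos_max.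
- by move=> x; have [] := is_derive_cos_affine y b x.
- by have := is_derive_cos_affine y b 0; rewrite mulr0 add0r.
- by rewrite cE; exact: (integrableB _ i1 i2).
rewrite cE RintegralB// RintegralZl//; last exact: integrable_psi_re.
rewrite RintegralZl//; last exact: integrable_psi_im.
pose g t := expR (t * psi_re phi y) * cos (t * psi_im phi y + b).
rewrite (_ : (fun n => _) = (fun n => n.+1%:R * (g n.+1%:R^-1 - g 0))).
  apply: is_derive_cvg_harmonic.
  have d1 : is_derive (0 : R) (1 : R) (fun t => expR (t * psi_re phi y)) (psi_re phi y).
    have a : is_derive (0 : R) (1 : R) (fun z : R => z * psi_re phi y) (psi_re phi y).
      under eq_fun do rewrite mulrC.
      rewrite -[X in is_derive _ _ _ X]mulr1; exact: (@is_deriveZ _ _ _ id _).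
    have := @is_derive1_comp R expR (fun z => z * psi_re phi y) 0 _ _ (is_derive_expR (0 * psi_re phi y)) a.
    by rewrite mul0r expR0 mul1r.
  have d2 : is_derive (0 : R) (1 : R) (fun t => cos (t * psi_im phi y + b)) (- (psi_im phi y * sin b)).
    have := is_derive_cos_affine (psi_im phi y) b 0.
    by rewrite mulr0 add0r; under eq_fun do rewrite mulrC.
  have := is_deriveM d1 d2.
  rewrite /GRing.scale/= !mul0r expR0 add0r mul1r.
  by rewrite [- _ + _]addrC [psi_im _ _ * _]mulrC.
apply/funext => n; rewrite (expectation_cos mX charX)//.
by rewrite mulr0 add0r /g !mul0r expR0 mul1r add0r.
Qed.

(* The cosine factor makes this class closed under multiplication by
   1 - cos (s * x + c), by the product-to-sum formula. *)
Definition generator_stable (f : R -> R) :=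
  forall y b, exists D, generator_at (fun x => f x * cos (y * x + b)) D.

Lemma generator_stable_at f : generator_stable f -> exists D, generator_at f D.
Proof.
move=> /(_ 0 0)[D]; rewrite (_ : (fun x => _) = f); first by exists D.
by apply/funext => x; rewrite mul0r addr0 cos0 mulr1.
Qed.

Lemma generator_stable1 : generator_stable (fun=> 1).
Proof.
move=> y b; exists (- (y * sin b)); under eq_fun do rewrite mul1r.
exact: generator_at_cos.
Qed.

Lemma generator_stableZ c f : generator_stable f -> generator_stable (fun x => c * f x).
Proof.
move=> Sf y b; have [D GD] := Sf y b; exists (c * D).
by under eq_fun do rewrite -mulrA; exact: generator_at_scale.
Qed.

Lemma generator_stable_cos f (s c : R) : generator_stable f ->
  generator_stable (fun x => f x * (1 - cos (s * x + c))).
Proof.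
move=> Sf y b.
have [D0 G0] := Sf y b; have [D1 G1] := Sf (y + s) (b + c); have [D2 G2] := Sf (y - s) (b - c).
exists (D0 + - 2^-1 * (D1 + D2)).
rewrite (_ : (fun x => _) = (fun x => f x * cos (y * x + b) +
   - 2^-1 * (f x * cos ((y + s) * x + (b + c)) + f x * cos ((y - s) * x + (b - c))))).
  by apply: generator_at_add G0 _; apply: generator_at_scale; exact: generator_at_add.
apply/funext => x.
have -> : (y + s) * x + (b + c) = (y * x + b) + (s * x + c) by ring.
have -> : (y - s) * x + (b - c) = (y * x + b) - (s * x + c) by ring.
by move: (y * x + b) (s * x + c) => u v; rewrite cosB cosD; field.
Qed.

(* After rescaling, the N-th factor vanishes at 2 ^ (m - N), is at most 1 at the
   smaller powers of 2, and at least 1 on [- 2 ^ m, 0]. *)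
Lemma test_function (m N : nat) (t := pi / (2 * 2 ^+ m) : R) :
  exists p : R -> R, [/\ generator_stable p,
    (forall x, 0 <= p x) /\ p 0 = 0,
    forall x, 0 <= x <= 2 ^+ m -> 1 - cos (2 * t * x) <= p (- x),
    forall k : int, (m%:Z - N%:Z < k)%R -> p (2 ^ k) = 0 &
    forall k : int, (k <= m%:Z - N%:Z)%R -> p (2 ^ k) <= 2 * t ^+ 2 * (2 ^ k) ^+ 2].
Proof.
have p0 := @pi_gt0 R; have pm : 0 < (2 : R) ^+ m by rewrite exprn_gt0.
have t0 : 0 < t by rewrite /t divr_gt0// mulr_gt0.
elim: N => [|N [p [Sp [p_ge0 p00] pneg pzero ple]]].
  exists (fun x => 1 * (1 - cos (2 * t * x + 0))); split.
  - exact/generator_stable_cos/generator_stable1.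
  - split=> [x|]; first by rewrite mul1r subr_ge0 cos_le1.
    by rewrite mulr0 addr0 cos0 subrr mulr0.
  - by move=> x _; rewrite mul1r addr0 mulrN cosN.
  - move=> k; rewrite subr0 -lezD1 -subr_ge0; case E : (k - _) => [n|//] _.
    have -> : k = m%:Z + 1 + n%:Z by rewrite -E; ring.
    (* As 2 t = pi / 2^m, every power of 2 above 2^m gives a multiple of the period. *)
    rewrite (_ : 2 * t * _ + 0 = (pi *+ 2) *+ (2 ^ n)).
      by rewrite cos_2pi_natmul subrr mulr0.
    rewrite !expfzDr// expr1z -!exprnP -[RHS]mulr_natr natrX -[pi *+ 2]mulr_natr /t.
    by field; rewrite gt_eqF.
  - move=> k _; rewrite mul1r addr0; apply: le_trans (subr1_cos_le_sqr _) _.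
    by rewrite le_eqVlt; apply/orP; left; apply/eqP; field.
(* The phase [a = t 2^(m-N)] puts the new zero at 2^(m-N), and 1 - cos a is the value of the new
   factor at 0. Smaller atoms have phase in [0, a], while points of [-2^m, 0] have phase of modulus
   in [a, pi], as both [a] and [t 2^m] are at most pi / 2. *)
pose a : R := pi / 2 ^+ N.+1.
have a0 : 0 < a by rewrite divr_gt0// exprn_gt0.
have api : a <= pi / 2.
  by rewrite ler_pM2l// lef_pV2 ?posrE ?exprn_gt0// exprS ler_peMr// exprn_ege1// ler1n.
have c0 : 0 < 1 - cos a.
  by rewrite subr_gt0 -[ltRHS]cos0 ltr_cos ?in_itv/= ?lexx ?pi_ge0 ?(ltW a0)//=; lra.
have ta : t * 2 ^ (m%:Z - N%:Z) = a.
  rewrite exprzBn -exprnP /t /a exprS; field.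
  by rewrite !gt_eqF// exprn_gt0.
exists (fun x => (1 - cos a)^-1 * (p x * (1 - cos (t * x + - a)))); split.
- exact/generator_stableZ/generator_stable_cos.
- split=> [x|]; last by rewrite p00 mul0r mulr0.
  by rewrite !mulr_ge0// ?invr_ge0 ?(ltW c0)// subr_ge0 cos_le1.
- move=> x /andP[x0 xm]; apply: le_trans (pneg x _) _; first by rewrite x0.
  rewrite mulrCA; apply: ler_peMr => //.
  rewrite ler_pdivlMl// mulr1 lerB//.
  rewrite (_ : t * - x + - a = - (t * x + a)); last by ring.
  rewrite cosN.
  have tx : t * x <= pi / 2.
    apply: (@le_trans _ _ (t * 2 ^+ m)); first by rewrite ler_pM2l.
    by rewrite /t le_eqVlt; apply/orP; left; apply/eqP; field; rewrite gt_eqF.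
  have tx0 : 0 <= t * x by rewrite mulr_ge0// ltW.
  by apply: cos_antitone; lra.
- move=> k kN; have [->|kN'] := eqVneq k (m%:Z - N%:Z).
    by rewrite ta subrr cos0 subrr !mulr0.
  rewrite pzero ?mul0r ?mulr0// lt_neqAle eq_sym kN'/=.
  by move: kN; rewrite -lezD1 intS; lra.
- move=> k kN; have kN' : (k <= m%:Z - N%:Z)%R.
    by apply: le_trans kN _; rewrite lerD2l lerN2 lez_nat.
  apply: le_trans _ (ple k kN'); rewrite mulrCA; apply: ler_piMr => //.
  rewrite ler_pdivrMl// mulr1 lerB// -[X in _ <= X]cosN.
  rewrite (_ : - (t * 2 ^ k + - a) = a - t * 2 ^ k); last by ring.
  have tk : t * 2 ^ k <= a by rewrite -ta ler_pM2l// ler_weXz2l// ler1n.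
  have tk0 : 0 <= t * 2 ^ k by rewrite mulr_ge0 ?exprz_ge0// ltW.
  by apply: cos_antitone; lra.
Qed.

(** Markov's inequality for a test function [p] that is at least [c] on the interval, while n E
    p(X(1/n)) tends to the integral of [p]. That integral sees only atoms up to 2^(m-N), where [p]
    is quadratic, so it is O(2^(m-N)); [c] does not depend on [N]. *)
Lemma negative_increment_bound (m : nat) (eps e : R) : 0 < eps -> 0 < e ->
  \forall n \near \oo,
  ((n.+1%:R)%:E * P [set w | (- 2 ^+ m <= X n.+1%:R^-1 w <= - eps)%R] <= e%:E)%E.
Proof.
move=> eps0 e0; have pm : 0 < (2 : R) ^+ m by rewrite exprn_gt0.
wlog epsm : eps eps0 / eps <= 2 ^+ m.
  move=> H; have [le_eps|em] := leP eps (2 ^+ m); first exact: H.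
  apply: nearW => n; rewrite (_ : [set w | _] = set0) ?measure0 ?mule0 ?lee_fin ?ltW//.
  by apply/seteqP; split => // w /= /andP[h1 h2]; lra.
pose t : R := pi / (2 * 2 ^+ m).
have p0 := @pi_gt0 R.
have t0 : 0 < t by rewrite /t divr_gt0// mulr_gt0.
have tm : 2 * t * 2 ^+ m = pi by rewrite /t; field; rewrite gt_eqF.
(* The minimum of 1 - cos (2 t x) on [eps, 2^m], where 2 t x stays in ]0, pi]. *)
pose c := 1 - cos (2 * t * eps).
have te : 2 * t * eps <= pi by rewrite -tm ler_wpM2l// mulr_ge0// ltW.
have te0 : 0 < 2 * t * eps by rewrite !mulr_gt0.
have c0 : 0 < c.
  by rewrite subr_gt0 -[ltRHS]cos0 ltr_cos ?in_itv/= ?lexx ?pi_ge0 ?te ?(ltW te0).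
(* The 4 is the factor 2 in the bound on [p] times the factor 2 of [int_sqr_le]. *)
have [N HN] : exists N, 4 * t ^+ 2 * 2 ^ (m%:Z - N%:Z) < c * e.
  have : (fun n => 4 * t ^+ 2 * 2 ^+ m * (2^-1) ^+ n) @ \oo --> 0.
    by apply: cvg_geometric; rewrite ger0_norm//; lra.
  move=> /cvgr_lt /(_ (c * e))/(_ (mulr_gt0 c0 e0))[N _ H]; exists N.
  by have := H N (leqnn N); rewrite exprzBn -exprnP -exprVn [X in _ -> X < _]mulrA.
have [p [Sp [p_ge0 p00] pneg pzero ple]] := test_function m N.
have [D GD] := generator_stable_at Sp.
(* [p] has a minimum at 0, so the compensator disappears. *)
have D0 : D = 0.
  have [dp E] := gen_derive GD.
  have [] : is_derive (0 : R) (1 : R) p 0.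
    apply: (@derive1_at_min R p (-1) 1 0).
    - by rewrite -subr_ge0 opprK addr_ge0.
    - by move=> x _; exact: gen_derivable GD x.
    - by rewrite in_itv/= ltr01 ltrN10.
    - by move=> x _; rewrite p00.
  by rewrite E.
have cE : compensated p D = p by apply/funext => x; rewrite /compensated D0 p00 !mul0r !subr0.
have Ip : phi.-integrable `]0%R, +oo[ (EFin \o p) by have := gen_integrable GD; rewrite cE.
have mp : measurable_fun [set: measurableTypeR R] (EFin \o p).
  by apply/measurable_EFinP; exact: gen_measurable GD.
have intp : (\int[phi]_(x in `]0%R, +oo[) p x <= 4 * t ^+ 2 * 2 ^ (m%:Z - N%:Z))%R.
  set k0 := m%:Z - N%:Z.
  rewrite -lee_fin /Rintegral fineK; last exact: integrable_fin_num.
  have -> : `]0%R, +oo[%classic = `]0%R, (2 : R) ^ k0]%classic `|` `](2 : R) ^ k0, +oo[%classic :> set R.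
    by rewrite -itv_bndbnd_setU// bnd_simp; exact: exprz_ge0.
  rewrite ge0_integral_setU//; last 3 first.
  - by apply: measurable_funS mp.
  - by move=> x _; rewrite lee_fin.
  - apply/disj_set2P/seteqP; split => // x /=; rewrite !in_itv/= andbT => -[/andP[_ x1]].
    by rewrite ltNge x1.
  (* The bounds on [p] are known only at the powers of 2, hence almost everywhere for [phi]. *)
  have nD : phi.-negligible (~` [set (2 : R) ^ k | k in [set: int]]).
    apply/negligibleP; last exact: phiP.1.
    by apply: measurableC; apply: countable_measurable => //; exact: countable_dyadic.
  rewrite -[leRHS]adde0; apply: leeD.
    apply: (@le_trans _ _ (\int[phi]_(x in `]0%R, (2 : R) ^ k0]) ((2 * t ^+ 2)%:E * (x ^+ 2)%:E))%E).
      apply: ae_ge0_le_integral => //.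
      - by move=> x _; rewrite lee_fin.
      - by apply: measurable_funS mp.
      - by move=> x _; rewrite -EFinM lee_fin; apply: mulr_ge0; rewrite ?sqr_ge0//; apply: mulr_ge0; rewrite ?sqr_ge0.
      - apply/measurable_EFinP; apply: measurable_funM; first exact: measurable_cst.
        by apply: measurable_funTS; exact: exprn_measurable.
      - apply: negligibleS nD => x /= H [k _ E]; apply: H; rewrite -E in_itv/= => /andP[_ kk].
        by rewrite -EFinM lee_fin ple// -(@ler_eXz2l R 2)// ltr1n.
    rewrite ge0_integralZl//; last 3 first.
    - by apply/measurable_EFinP; apply: measurable_funTS; exact: exprn_measurable.
    - by move=> x _; rewrite lee_fin sqr_ge0.
    - by rewrite lee_fin; apply: mulr_ge0; rewrite ?sqr_ge0.
    apply: le_trans (lee_wpmul2l _ (int_sqr_le phiP k0)) _.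
      by rewrite lee_fin; apply: mulr_ge0; rewrite ?sqr_ge0.
    by rewrite -EFinM lee_fin le_eqVlt; apply/orP; left; apply/eqP; ring.
  rewrite -[leRHS](integral0 phi `](2 : R) ^ k0, +oo[%classic).
  apply: ae_ge0_le_integral => //.
  - by move=> x _; rewrite lee_fin.
  - by apply: measurable_funS mp.
  - apply: negligibleS nD => x /= H [k _ E]; apply: H; rewrite -E in_itv/= andbT => kk.
    by rewrite pzero// -(@ltr_eXz2l R 2)// ltr1n.
have := gen_limit GD; rewrite cE p00 => /cvgr_lt /(_ (c * e))/(_ (le_lt_trans intp HN)).
apply: filterS => n; rewrite subr0 => Hn.
have mS : measurable [set w | - 2 ^+ m <= X n.+1%:R^-1 w <= - eps].
  rewrite (_ : [set w | _] = setT `&` X n.+1%:R^-1 @^-1` `[- 2 ^+ m, - eps]).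
    exact: mX.
  by rewrite setTI; apply/seteqP; split => w /=; rewrite in_itv.
have := @markov_set _ _ _ P (fun w => p (X n.+1%:R^-1 w)) c _ mS (gen_integrableP n GD) (fun=> p_ge0 _).
move=> /(_ _)/wrap[w /= /andP[w1 w2]|H].
  rewrite -[X in p X]opprK; apply: le_trans _ (pneg _ _); last first.
    by rewrite oppr_ge0 (le_trans w2) ?oppr_le0 ?(ltW eps0)//= lerNl.
  have t2 : 0 < 2 * t by rewrite mulr_gt0.
  rewrite /c lerB//; apply: cos_antitone; first exact: ltW.
    by rewrite ler_pM2l// lerNr.
  by rewrite -[leRHS]tm ler_pM2l// lerNl.
rewrite -(@lee_pmul2l _ c%:E)//.
rewrite muleCA; apply: (@le_trans _ _ ((n.+1%:R)%:E * (\int[P]_w p (X n.+1%:R^-1 w))%R%:E)%E).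
  by apply: lee_wpmul2l.
by rewrite -EFinM lee_fin ltW.
Qed.

End Generator.

(** * Negligible sets *)

Section NegligibleSets.
Context {R : realType} d {T : measurableType d} (P : probability T R).

(** [A] need not be measurable: the intersection of the covers for e = 1/(n+1) is a measurable null
    set containing it. *)
Lemma negligible_small (A : set T) :
  (forall e : R, 0 < e -> exists B, [/\ measurable B, A `<=` B & (P B <= e%:E)%E]) ->
  P.-negligible A.
Proof.
move=> H.
have /choice[B HB] (n : nat) : exists B, [/\ measurable B, A `<=` B & (P B <= (n.+1%:R^-1)%:E)%E].
  by apply: H; rewrite invr_gt0.
have mB : measurable (\bigcap_n B n) by apply: bigcapT_measurable => n; have [] := HB n.
exists (\bigcap_n B n); split => //; last by move=> w Aw n _; have [_ AB _] := HB n; exact: AB.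
apply/eqP; rewrite eq_le measure_ge0 andbT; apply/lee_addgt0Pr => e e0; rewrite add0e.
have [n _ /(_ n (leqnn n)) ne] : \forall n \near \oo, n.+1%:R^-1 <= e.
  by have := @cvg_harmonic R => /cvgr_le; apply.
have [mBn _ Be] := HB n; apply: le_trans (le_trans Be _); last by rewrite lee_fin.
by apply: le_measure; rewrite ?inE//; exact: bigcap_inf.
Qed.

Lemma measure_le_ae (A B : set T) : measurable A -> measurable B ->
  {ae P, forall w, A w -> B w} -> (P A <= P B)%E.
Proof.
move=> mA mB [N [mN PN sub]].
have AB : A `<=` B `|` N.
  by move=> w Aw; have [Bw|nB] := pselect (B w); [left|right; apply: sub => /(_ Aw)].
apply: (@le_trans _ _ (P (B `|` N))).
  by apply: le_measure; rewrite ?inE//; exact: measurableU.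
by apply: le_trans (measureU2 P mB mN) _; rewrite [X in (_ + X)%E]PN adde0.
Qed.

End NegligibleSets.

(** * Deterministic properties of càdlàg paths *)

Section Paths.
Context {R : realType}.

(** On every fine grid, the cell around a downward jump of size [J] has an increment close to -J.
    This trades the uncountably many jump times for countably many parameters and finitely many
    cells. *)
Lemma cadlag_downward_jump (f : R -> R) (t : R) : cadlag f -> 0 < t <= 1 ->
  ~ no_downward_jump f t ->
  exists m q N, forall n, (N <= n)%N -> exists2 i, (i < n.+1)%N &
    - 2 ^+ m <= f (i%:R / n.+1%:R + n.+1%:R^-1) - f (i%:R / n.+1%:R) <= - q.+1%:R^-1.
Proof.
move=> [rc ll] /andP[t0 t1] nd.
have := ll t t0; set l := lim _; move=> fl.
have ftl : f t < l.
  by rewrite ltNge; apply/negP => H; apply: nd; exists l.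
pose J := l - f t; have J0 : 0 < J by rewrite subr_gt0.
have [q qJ] : exists q : nat, q.+1%:R^-1 < J.
  by have := @cvg_harmonic R => /cvgr_lt /(_ J J0)[q _ H]; exists q; exact: H q (leqnn q).
have [m mJ] : exists m, J < 2 ^+ m.
  exists (Num.bound J); apply: lt_trans (archi_boundP (ltW J0)) _.
  by rewrite -natrX ltr_nat ltn_expl.
(* [J] lies strictly between 1/(q+1) and 2^m; the margin is shared by the errors at the two ends of
   the cell. *)
pose eta := Num.min (J - q.+1%:R^-1) (2 ^+ m - J) / 2.
have eta0 : 0 < eta by rewrite divr_gt0// lt_min !subr_gt0 qJ mJ.
have eta1 : 2 * eta <= J - q.+1%:R^-1 by rewrite mulrC divfK// ge_min lexx.
have eta2 : 2 * eta <= 2 ^+ m - J by rewrite mulrC divfK// ge_min lexx orbT.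
have [d1 /= d10 H1] : \forall s \near t^'-, `|l - f s| < eta.
  by move/cvgrPdist_lt : fl; apply.
have [d2 /= d20 H2] : \forall s \near t^'+, `|f t - f s| < eta.
  by have /cvgrPdist_lt := rc t (ltW t0); apply.
have [N _ HN] : \forall n \near \oo, n.+1%:R^-1 < Num.min d1 d2.
  by have := @cvg_harmonic R => /cvgr_lt; apply; rewrite lt_min d10 d20.
exists m, q, N => n Nn; have := HN n Nn; rewrite /= lt_min => /andP[nd1 nd2].
have n0 : 0 < n.+1%:R :> R by [].
have ex : exists j : nat, t * n.+1%:R <= j%:R.
  by exists n.+1; rewrite ler_piMl.
(* Minimality makes the cell open on the left, so that the left limit governs its left end. Its
   right end may equal [t]. *)
case: (ex_minnP ex) => -[|i] ti mini.
  by move: ti; rewrite leNgt mulr_gt0.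
have it : i%:R < t * n.+1%:R.
  by rewrite ltNge; apply/negP => /mini; rewrite ltnn.
have st : i%:R / n.+1%:R < t by rewrite ltr_pdivrMr.
have su : t <= i%:R / n.+1%:R + n.+1%:R^-1.
  by rewrite -[X in _ + X]mul1r -mulrDl natr1 ler_pdivlMr.
exists i.
  by rewrite -(ltr_nat R); apply: lt_le_trans it _; rewrite ler_piMl.
set s := i%:R / _ in st su *; set u := s + _ in su *.
have us : u < t + n.+1%:R^-1 by rewrite ltrD2r.
have fs : `|l - f s| < eta.
  by apply: H1 => //; rewrite /= gtr0_norm ?subr_gt0//; apply: le_lt_trans nd1; rewrite lerBlDr addrC.
have fu : `|f t - f u| < eta.
  move: su; rewrite le_eqVlt => /orP[/eqP <-|tu]; first by rewrite subrr normr0.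
  apply: H2 => //; rewrite /= ltr0_norm ?subr_lt0// opprB; apply: lt_trans nd2.
  by rewrite ltrBlDl.
have bracket (l' a b c e p M : R) : `|l' - a| < e -> `|b - c| < e ->
    2 * e <= l' - b - p -> 2 * e <= M - (l' - b) -> - M <= c - a <= - p.
  by rewrite !ltr_norml => /andP[? ?] /andP[? ?] ? ?; apply/andP; split; lra.
exact: bracket fs fu eta1 eta2.
Qed.

(** The filter and the limit [l] are arbitrary so as to serve both right limits and left limits, the
    latter possibly different from [x t]. *)
Lemma cvg_normalized (x : R -> R) (t l : R) (F : set_system R) : Filter F ->
  0 < t -> F --> t -> x s @[s --> F] --> l ->
  s^-1 * (x s - s * log2 s) @[s --> F] --> t^-1 * (l - t * log2 t).
Proof.
move=> FF t0 Ft xl; have lnl : ln s @[s --> F] --> ln t.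
  by apply: cvg_comp Ft (continuous_ln t0).
apply: cvgM; first by apply: cvgV => //; rewrite gt_eqF.
by apply: cvgB => //; apply: cvgM => //; apply: cvgM => //; exact: cvg_cst.
Qed.

End Paths.

(** * Almost sure properties of the Lévy paths *)

Section LevyPaths.
Context {R : realType} d {T : measurableType d} (P : probability T R).
Context (phi : {measure set (measurableTypeR R) -> \bar R}) (X : R -> T -> R).
Hypothesis phiP : st_petersburg_levy_measure phi.
Hypothesis levyX : levy_process P X.
Hypothesis charX : forall t y : R, 0 <= t ->
  char_fun P (X t) y = cexp (t%:C * levy_exponent phi y).

Let mX := levy_measurable levyX.

Lemma measurable_increment s h (B : set R) : 0 <= s -> 0 <= h -> measurable B ->
  measurable [set w | B (X (s + h) w - X s w)].
Proof.
move=> s0 h0 mB; have := measurable_funB (mX (addr_ge0 s0 h0)) (mX s0).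
by move=> /(_ measurableT B mB); rewrite setTI.
Qed.

Lemma increment_law s h (B : set R) : 0 <= s -> 0 <= h -> measurable B ->
  P [set w | B (X (s + h) w - X s w)] = P [set w | B (X h w)].
Proof.
move=> s0 h0 mB; rewrite (levy_stationary_increments levyX)//.
have m1 : measurable [set w | B (X h w - X 0 w)].
  by have := @measurable_increment 0 h B (lexx _) h0 mB; rewrite add0r.
have m2 : measurable [set w | B (X h w)].
  by have := mX h0 measurableT mB; rewrite setTI.
apply/eqP; rewrite eq_le; apply/andP; split; apply: measure_le_ae => //;
  apply: filterS (levy_start levyX) => w /= ->; by rewrite subr0.
Qed.

(** By stationarity, a union bound over the n+1 cells gives at most (n+1) P(X(1/(n+1)) in I), which
    tends to 0. A path with a downward jump meets these events for all large n, for some [m] and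
    [q]; this is a countable union of null sets. *)
Lemma ae_no_downward_jump : {ae P, forall w, cadlag (X ^~ w) /\
  forall t, 0 < t <= 1 -> no_downward_jump (X ^~ w) t}.
Proof.
pose I m q : set R := `[- 2 ^+ m, - q.+1%:R^-1]%classic.
have mI m q : measurable (I m q) by exact: measurable_itv.
pose E m q n := \big[setU/set0]_(i < n.+1)
  [set w | I m q (X (i%:R / n.+1%:R + n.+1%:R^-1) w - X (i%:R / n.+1%:R) w)].
have i0 n (i : nat) : 0 <= i%:R / n.+1%:R :> R by rewrite divr_ge0.
have n0 n : 0 <= n.+1%:R^-1 :> R by rewrite invr_ge0.
have mE m q n : measurable (E m q n).
  by apply: bigsetU_measurable => i _; exact: measurable_increment (i0 n i) (n0 n) (mI m q).
have PE m q (e : R) : 0 < e -> \forall n \near \oo, (P (E m q n) <= e%:E)%E.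
  move=> e0; have q0 : 0 < q.+1%:R^-1 :> R by rewrite invr_gt0.
  have := negative_increment_bound phiP mX charX m q0 e0.
  apply: filterS => n; apply: le_trans.
  apply: (@le_trans _ _ (\sum_(i < n.+1) P [set w | I m q (X n.+1%:R^-1 w)])%E).
    pose F i := [set w | I m q (X (i%:R / n.+1%:R + n.+1%:R^-1) w - X (i%:R / n.+1%:R) w)].
    have mF i : measurable (F i) by exact: measurable_increment (i0 n i) (n0 n) (mI m q).
    apply: (@le_trans _ _ (\sum_(i < n.+1) P (F i))%E).
      by apply: content_subadditive.
    by apply: lee_sum => i _; rewrite (increment_law (i0 n i) (n0 n) (mI m q)).
  have sumc (a : \bar R) k : (0 <= a)%E -> (\sum_(i < k) a = (k%:R)%:E * a)%E.
    move=> a0; elim: k => [|k IH]; first by rewrite big_ord0 mul0e.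
    by rewrite big_ord_recr/= IH -natr1 EFinD ge0_muleDl ?lee_fin// mul1e.
  rewrite sumc ?measure_ge0//; exact: lee_wpmul2l.
have nE m q N : P.-negligible (\bigcap_(n in [set n | (N <= n)%N]) E m q n).
  apply: negligible_small => e e0; have [M _ HM] := PE m q e e0.
  exists (E m q (maxn M N)); split => //; last by apply: HM; exact: leq_maxl.
  by apply: bigcap_inf; exact: leq_maxr.
have nC := levy_cadlag levyX.
have nE' : P.-negligible (\bigcup_m \bigcup_q \bigcup_N
   \bigcap_(n in [set n | (N <= n)%N]) E m q n).
  by do 3 (apply: negligible_bigcup => ?).
apply: negligibleS (negligibleU nC nE') => w /= Hw.
have [cw|] := pselect (cadlag (X ^~ w)); last by left.
right; move/not_andP : Hw => [//|/existsNP[t /not_implyP[t01 nd]]].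
have [m [q [N H]]] := cadlag_downward_jump cw t01 nd.
exists m => //; exists q => //; exists N => // n Nn.
have [i ilt Hi] := H n Nn; rewrite /E -(bigcup_mkord n.+1 (fun i : nat =>
  [set w | I m q (X (i%:R / n.+1%:R + n.+1%:R^-1) w - X (i%:R / n.+1%:R) w)])).
by exists i.
Qed.

(** For fixed [K], failure at every [m] is contained in failure at the single [m] that
    [steep_descent] supplies for [e]. *)
Lemma ae_steep_descent (s : R) : 0 <= s -> {ae P, forall w, forall K : nat,
  exists2 m, (0 < m)%N & X (s + 2 ^- m) w - X s w < - K%:R * 2 ^- m}.
Proof.
move=> s0; apply/ae_foralln => K; apply: negligible_small => e e0.
have [m m0 Pm] := steep_descent phiP mX charX K%:R e0.
have hm : 0 <= (2 : R) ^- m by rewrite invr_ge0 exprn_ge0.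
exists [set w | `[- K%:R * 2 ^- m, +oo[%classic (X (s + 2 ^- m) w - X s w)]; split.
- exact: measurable_increment.
- move=> w /= Hw; rewrite in_itv/= andbT leNgt; apply/negP => lt; apply: Hw.
  by exists m.
- rewrite increment_law//; apply: le_trans Pm.
  by rewrite le_eqVlt; apply/orP; left; apply/eqP; congr (P _); apply/seteqP; split => w; rewrite /= in_itv/= andbT.
Qed.

End LevyPaths.

(** * An interval in the range of the normalized process *)

Theorem theorem2p1 (R : realType) (d : measure_display)
    (T : measurableType d) (P : probability T R)
    (phi : {measure set (measurableTypeR R) -> \bar R})
    (X : R -> T -> R) :
  st_petersburg_levy_measure phi ->
  levy_process P X ->
  (forall t y : R, 0 <= t ->
     char_fun P (X t) y = cexp (t%:C * levy_exponent phi y)) ->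
  {ae P, forall w,
     hausdorff_dim
       [set st_petersburg_normalized X t w | t in `[2^-1, 1]] = 1%:E}.
Proof.
move=> phiP levyX charX.
have h0 : 0 < 2^-1 :> R by rewrite invr_gt0.
have := ae_steep_descent phiP levyX charX (ltW h0).
have := ae_no_downward_jump phiP levyX charX.
apply: filterS2 => w [[rc _] nd] sd.
pose f t := st_petersburg_normalized X t w.
(* With b = 1/2 + h, the inequality X(b)/b < 2 X(1/2) reads X(b) - X(1/2) < 2 h X(1/2), and this
   choice makes -K h smaller than the right side. *)
have [K XK] : exists K : nat, - X 2^-1 w < K%:R / 2.
  exists (Num.bound (2 * `|X 2^-1 w|)); rewrite ltr_pdivlMr// mulrC.
  apply: le_lt_trans (archi_boundP _); last by rewrite mulr_ge0.
  by rewrite ler_wpM2l// -normrN ler_norm.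
have [m m0 Xm] := sd K.
set h : R := 2 ^- m in Xm; pose b : R := 2^-1 + h.
have hh : 0 < h by rewrite invr_gt0 exprn_gt0.
have b1 : b <= 1.
  (* Here [m > 0] keeps [b] inside the time interval. *)
  have : h <= 2^-1 by rewrite lef_pV2 ?posrE ?exprn_gt0// -{1}(expr1 2) ler_eXn2l ?ltr1n.
  by rewrite /b; lra.
have ab : 2^-1 < b by rewrite ltrDl.
have fab : f b < f 2^-1.
  have b0 : 0 < b by rewrite (lt_trans h0).
  (* The centring is subtracted and increases with time, so it only helps the descent. *)
  have lb : log2 2^-1 <= log2 b.
    by rewrite ler_wpM2r ?invr_ge0 ?ln_ge0 ?ler1n// ler_ln ?posrE// ltW.
  rewrite /f /st_petersburg_normalized !mulrBr !mulKf ?gt_eqF//.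
  apply: ltr_leB => //.
  rewrite invrK ltr_pdivrMl//.
  by move: XK Xm; rewrite -/b /b; nra.
apply: (hausdorff_dim_interval fab) => c; rewrite /= in_itv/= => fc.
have fr t : 2^-1 <= t < b -> f s @[s --> t^'+] --> f t.
  move=> /andP[t1 t2]; have t0 : 0 < t by rewrite (lt_le_trans h0).
  by apply: cvg_normalized => //; [exact: cvg_at_right_filter|exact: rc (ltW t0)].
have fl t : 2^-1 < t <= b -> no_downward_jump f t.
  move=> /andP[t1 t2]; have t0 : 0 < t by rewrite (lt_trans h0).
  have [|l Xl lX] := nd t; first by rewrite t0 (le_trans t2).
  exists (t^-1 * (l - t * log2 t)); last first.
    by apply: ler_wpM2l; [rewrite invr_ge0 ltW|exact: lerB].
  by apply: cvg_normalized => //; exact: cvg_at_left_filter.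
have [t /andP[t1 t2] <-] := no_downward_jump_IVT ab fr fl fc.
by exists t => //; rewrite /= in_itv/= t1 (le_trans t2).
Qed.
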